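(* Let $\beta\in[1,2)$ and $\gamma\in(0,2]\setminus\{1\}$. Let $S$ be a random walk on $\mathbb Z$ with i.i.d. symmetric increments in the normal basin of attraction of a $\beta$-stable law, let $(\zeta_k)_{k\in\mathbb Z}$ be i.i.d. positive random variables, independent of $S$, in the normal basin of attraction of a $\gamma$-stable law, and let $Y_n=\omega_{S_n}$ be the random walk on the random medium $\omega$ with inter-distances $\zeta_k$. Let $\mathcal T=\min\{n>0:S_n>0\}$, $L_{\mathcal T}(Y)=\sum_{k=1}^{\mathcal T}|Y_k-Y_{k-1}|$ the first-ladder length of $Y$, and $\hat\gamma=\min\{1,\gamma\}$. Then, for all sufficiently large $x$, $$K_{low}(x)\,x^{-\min\{1/2,\ \hat\gamma\beta/2\}}\le \mathbb P\big(L_{\mathcal T}(Y)>x\big)\le K_{up}(x)\,x^{-\hat\gamma/2},$$ where $K_{low}(x)$ and $K_{up}(x)$ are positive constants if $\beta\ne1$, and suitable slowly varying functions (at infinity) if $\beta=1$.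
   Context: $S_0=0$, $S_n=\sum_{k=1}^n\xi_k$, with $\mathbb E[e^{is\xi_1}]=1-\nu s^\beta+o(s^\beta)$ as $s\to0^+$, $\nu>0$ (normal basin of attraction of a symmetric $\beta$-stable law). The random medium is $\omega_0=0$, $\omega_k-\omega_{k-1}=\zeta_k$ for $k\in\mathbb Z$. The $\zeta_k$ have characteristic function, as $\theta\to0^+$, $1-c\,e^{-i\pi\gamma/2}\theta^\gamma+o(\theta^\gamma)$ with $c>0$ if $\gamma\in(0,1)$; if $\gamma\in(1,2]$ they have finite mean $\mu>0$ and $\zeta_1-\mu$ is in the normal domain of attraction of a $\gamma$-stable law (so the characteristic function is $1+i\mu\theta+o(\theta)$). *)

(* Defs.v *)
From HB Require Import structures.
From mathcomp Require Import all_boot all_order all_algebra.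
From mathcomp Require Import complex.
From mathcomp Require Import all_classical all_reals all_analysis.

Set Implicit Arguments.
Unset Strict Implicit.
Unset Printing Implicit Defensive.

Import Order.TTheory GRing.Theory Num.Theory.
Import numFieldNormedType.Exports.

Local Open Scope classical_set_scope.
Local Open Scope ring_scope.
Local Open Scope complex_scope.

(* Integer-valued random variables: int carries the discrete sigma-algebra,
   as nat does in MathComp-Analysis. *)
HB.instance Definition _ := isPointed.Build int 0.
HB.instance Definition _ := @isMeasurable.Build default_measure_display
  int discrete_measurable discrete_measurable0
  discrete_measurableC discrete_measurableU.

Section independence.
Context d (T : measurableType d) (R : realType) (P : probability T R).

Definition mutually_independent (I : choiceType) d' (V : measurableType d')
    (X : I -> T -> V) : Prop :=
  forall (J : seq I) (A : I -> set V), uniq J -> (forall i, measurable (A i)) ->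
    P (\bigcap_(i in [set` J]) (X i @^-1` A i)) =
    (\prod_(i <- J) P (X i @^-1` A i))%E.

Definition identically_distributed (I : Type) d' (V : measurableType d')
    (X : I -> T -> V) : Prop :=
  forall i j (A : set V), measurable A -> P (X i @^-1` A) = P (X j @^-1` A).

Definition process_sigma_algebra (I : Type) d' (V : measurableType d')
    (X : I -> T -> V) : set (set T) :=
  <<s \bigcup_i preimage_set_system setT (X i) measurable >>.

Definition independent_processes (I : Type) d1 (V : measurableType d1)
    (X : I -> T -> V) (J : Type) d2 (W : measurableType d2)
    (Y : J -> T -> W) : Prop :=
  forall A B, process_sigma_algebra X A -> process_sigma_algebra Y B ->
    P (A `&` B) = (P A * P B)%E.

Definition symmetric_law (X : T -> int) : Prop :=
  forall k : int, P (X @^-1` [set k]) = P (X @^-1` [set - k]).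

End independence.

Section stable.
Context (R : realType).

Definition expi (t : R) : R[i] := cos t +i* sin t.

(* E[e^{isX}], the expectation being taken componentwise *)
Definition charf d (T : measurableType d) (P : probability T R) (X : T -> R)
    (s : R) : R[i] :=
  (\int[P]_w complex.Re (expi (s * X w))) +i* (\int[P]_w complex.Im (expi (s * X w))).

(* Non-degenerate laws m such that, for X1, X2 independent of law m and
   a, b > 0, a X1 + b X2 is distributed as (a^g + b^g)^{1/g} X1 + e
   for some constant e. *)
Definition stable_law (g : R) (m : probability (measurableTypeR R) R) : Prop :=
  (forall x : R, m [set x] != 1%E) /\
  forall a b : R, 0 < a -> 0 < b -> exists e : R,
    forall A : set (measurableTypeR R), measurable A ->
      (m \x m)%E [set z | A (a * z.1 + b * z.2)] =
      m [set x | A ((a `^ g + b `^ g) `^ g^-1 * x + e)].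

Definition converges_in_law d (T : measurableType d) (P : probability T R)
    (Z : nat -> T -> R) (m : probability (measurableTypeR R) R) : Prop :=
  forall f : R -> R, continuous f -> bounded_fun f ->
    (\int[P]_w f (Z n w)) @[n --> \oo] --> \int[m]_x f x.

(* The common law of the i.i.d. variables X 0, X 1, ... is in the normal domain
   of attraction of a g-stable law: the norming is by n^{1/g} exactly, its
   multiplicative constant being absorbed by the limit law. *)
Definition normal_domain_of_attraction d (T : measurableType d)
    (P : probability T R) (X : nat -> T -> R) (g : R) : Prop :=
  exists (m : probability (measurableTypeR R) R) (b : nat -> R),
    stable_law g m /\
    converges_in_law P
      (fun n w => (\sum_(k < n) X k w - b n) / (n%:R `^ g^-1)) m.

(* R[i]^o is R[i] as a normed module over itself; e is real and is embedded. *)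
Definition charf_expansion (phi main : R -> R[i]) (e : R -> R) : Prop :=
  (phi : R -> R[i]^o) = (main : R -> R[i]^o) +o_ (0^'+)
    (fun s => (e s)%:C : R[i]^o).

Lemma charf_expansionP (phi main : R -> R[i]) (e : R -> R) :
  charf_expansion phi main e <->
  forall eps : R, 0 < eps -> \forall s \near 0^'+,
    `|phi s - main s| <= (eps * `|e s|)%:C.
Proof.
have nE (a : R) : `|a%:C : (R[i])^o| = (`|a|)%:C :> R[i].
  by rewrite [LHS]normc_def /= expr0n addr0 sqrtr_sqr.
rewrite /charf_expansion; split.
- move=> H eps eps0.
  have := H => /eqaddoP /(_ (eps%:C)).
  rewrite ltcR => /(_ eps0) F.
  near=> s.
  have : `|phi s - main s| <= eps%:C * `|(e s)%:C| by near: s; exact: F.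
  by rewrite nE -rmorphM.
- move=> H; apply/eqaddoP => eps eps0.
  have [er -> er0] : exists2 er : R, eps = er%:C & 0 < er.
    case: eps eps0 => a b; rewrite ltcE /= => /andP[/eqP -> a0]; by exists a.
  near=> s.
  have : `|phi s - main s| <= (er * `|e s|)%:C by near: s; exact: H.
  by rewrite rmorphM nE.
Unshelve. all: by end_near.
Qed.

Definition symmetric_stable_basin d (T : measurableType d)
    (P : probability T R) (X : T -> int) (b : R) : Prop :=
  symmetric_law P X /\
  exists2 nu : R, 0 < nu &
    charf_expansion (charf P (fun w => (X w)%:~R))
      (fun s => 1 - (nu * s `^ b)%:C) (fun s => s `^ b).

(* For an i.i.d. family (zeta_k) with k in Z. *)
Definition stable_basin d (T : measurableType d) (P : probability T R)
    (zeta : int -> T -> R) (g : R) : Prop :=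
  (g < 1 -> exists2 c : R, 0 < c &
    charf_expansion (charf P (zeta 1))
      (fun s => 1 - (c * s `^ g)%:C * expi (- (pi * g / 2)))
      (fun s => s `^ g)) /\
  (1 < g -> P.-integrable setT (EFin \o zeta 1) /\
    exists mu : R, [/\ 0 < mu, ('E_P[zeta 1%R] = mu%:E)%E &
      normal_domain_of_attraction P (fun k w => zeta k.+1%:Z w - mu) g]).

Definition slowly_varying (L : R -> R) : Prop :=
  [/\ measurable_fun setT L, (\forall x \near +oo, 0 < L x) &
    forall a : R, 0 < a -> L (a * x) / L x @[x --> +oo] --> (1 : R)].

End stable.

Section random_walk.
Context (R : realType) (T : Type).

(* xi k is the (k+1)-st increment of the walk. *)
Definition walk (xi : nat -> T -> int) (n : nat) (w : T) : int :=
  \sum_(k < n) xi k w.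

(* The two-sided sums with increments zeta k = medium k - medium (k - 1),
   normalized by medium 0 = 0; recall that Negz n is - n.+1. *)
Definition medium (zeta : int -> T -> R) (k : int) (w : T) : R :=
  match k with
  | Posz n => \sum_(i < n) zeta i.+1%:Z w
  | Negz n => - \sum_(i < n.+1) zeta (- i%:Z) w
  end.

Lemma medium0 zeta w : medium zeta 0 w = 0.
Proof. exact: big_ord0. Qed.

Lemma mediumB zeta k w : medium zeta k w - medium zeta (k - 1) w = zeta k w.
Proof.
case: k => [[|n]|n].
- by rewrite sub0r /= big_ord0 big_ord1 sub0r opprK oppr0.
- have -> : n.+1%:Z - 1 = n%:Z by rewrite intS addrAC subrr add0r.
  by rewrite /= big_ord_recr /= addrAC subrr add0r.
- have -> : Negz n - 1 = Negz n.+1 by rewrite !NegzE -opprD -PoszD addn1.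
  by rewrite /= [X in _ - - X]big_ord_recr /= opprK addrA addNr add0r NegzE.
Qed.

Definition walk_on_medium (S : nat -> T -> int) (omega : int -> T -> R)
    (n : nat) (w : T) : R := omega (S n w) w.

(* min {n > 0 : S_n > 0}, equal to +oo when there is no such n *)
Definition ladder_time (S : nat -> T -> int) (w : T) : \bar R :=
  ereal_inf [set n%:R%:E | n in [set n : nat | (0 < n)%N /\ 0 < S n w]].

Definition ladder_length (tau : T -> \bar R) (Y : nat -> T -> R) (w : T)
    : \bar R :=
  (\sum_(1 <= k <oo | k%:R%:E <= tau w) `|Y k w - Y k.-1 w|%:E)%E.

End random_walk.

(* Main.v *)
(* The ladder length of Y is the sum of the |Y_(k+1) - Y_k| over the times k before
   S becomes positive.  Let a_n = P(S_1, ..., S_n <= 0) and b_n = P(S_1, ..., S_n < 0).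
   Splitting [0, n] at the first maximum of S gives sum_k b_k a_(n-k) = 1; together
   with b_(n+1) >= P(xi < 0) a_n and monotonicity, this alone pins a_n between two
   multiples of n^(-1/2).

   Upper bound: min(1, .) is subadditive and the medium is independent of S, so that
   P(L > x) <= a_n + (sum_(k < n) a_k) E min(1, q |xi|) with q = E min(1, zeta / x),
   which is O(x^(-gammahat)); take n ~ x^gammahat.  The expectation is O(q) if beta > 1
   and O(q log(1/q)) if beta = 1, whence the logarithm.

   Lower bound: conditionally on S_1, ..., S_N <= 0, the steps of [N, 2N) contribute
   more than x to the length with probability close to 1.  For N ~ x this follows by
   counting blocks of steps that contain an increment of Y of order 1; for gamma < 1
   and N ~ x^(gamma beta), a single jump of S over x^gamma bonds occurs, one of which is
   longer than x. *)

Require Import Defs.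
From mathcomp Require Import all_boot all_order all_algebra.
From mathcomp Require Import complex ring lra zify.
From mathcomp Require Import all_classical all_reals all_analysis.
From mathcomp Require Import measurable_realfun.

Set Implicit Arguments.
Unset Strict Implicit.
Unset Printing Implicit Defensive.

Import Order.TTheory GRing.Theory Num.Theory.
Import numFieldNormedType.Exports.

Local Open Scope classical_set_scope.
Local Open Scope ring_scope.

(** * Truncated moments and tails from the characteristic function *)

Section trigonometry.
Context (R : realType).
Implicit Types x y : R.

(** The hypotheses speak of characteristic functions, the argument of truncated moments and tails.
    The passage uses neither Fourier inversion nor a Tauberian theorem: the real part of the
    expansion gives the size of E(1 - cos(tX)), and pointwise inequalities between the scales t, t/2
    and 2t turn it, by dyadic iteration, into bounds on E min(1, (tX)^2), E min(1, |tX|) and P(|tX|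
    > 1). The cases b < 1, b = 1, b > 1 are those of 2^b / 2 below, equal to or above 1; at b = 1
    every dyadic scale contributes equally, which is the source of the logarithm. In the lower
    bound, the steps of [N, 2N) are independent of persistence up to N but not of persistence up to
    2N. The bad event is therefore estimated jointly with the former and subtracted from the
    probability of the latter. Both are known only up to factors depending on p = P(xi < 0), so the
    bad event must have relative probability at most p / 16; hence the constants p / 64 and p / 32.
    As the walk is integer-valued, conditioning on it is a sum over the countably many values of a
    finite list of steps. *)

Lemma sqr_sin_le y : sin y ^+ 2 <= y ^+ 2.
Proof.
wlog y0 : y / 0 < y => [hwlog|].
  case: (ltgtP 0 y) => [/hwlog//|y0|<-]; last by rewrite sin0.
  by rewrite -sqrrN -sinN -(sqrrN y) hwlog// oppr_gt0.
have [c _ E] := @MVT R sin cos 0 y y0 (fun x _ => is_derive_sin x)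
  (continuous_subspaceT (@continuous_sin R)).
have -> : sin y = cos c * y by move: E; rewrite sin0 !subr0.
by rewrite exprMn ler_piMl ?sqr_ge0.
Qed.

Lemma sin_ge_linear y : 0 <= y <= 1 -> cos 1 * y <= sin y.
Proof.
case/andP; rewrite le_eqVlt => /predU1P[<-|y0 y1]; first by rewrite sin0 mulr0.
have [c /[!in_itv]/= /andP[c0 cy] E] := @MVT R sin cos 0 y y0
  (fun x _ => is_derive_sin x) (continuous_subspaceT (@continuous_sin R)).
have -> : sin y = cos c * y by move: E; rewrite sin0 !subr0.
rewrite ler_wpM2r ?(ltW y0)// leNgt ltr_cos ?in_itv/=; last 2 first.
- by apply/andP; split; [lra|have := pi_ge2 R; lra].
- by apply/andP; split; [lra|have := pi_ge2 R; lra].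
by rewrite -leNgt; lra.
Qed.

Lemma subr1_cos x : 1 - cos x = 2 * sin (x / 2) ^+ 2.
Proof.
have {1}-> : x = (x / 2) *+ 2 by rewrite -mulr_natr mulfVK.
by rewrite cos_mulr2n cos2sin2 mulr2n; ring.
Qed.

Lemma subr1_cos_le x : 1 - cos x <= x ^+ 2 / 2.
Proof. by rewrite subr1_cos; have := sqr_sin_le (x / 2); lra. Qed.

(** Since [1 - cos x] vanishes at the multiples of 2 pi, it cannot suffice alone. It does for |x| <
    2, by [sin_ge_linear] at |x| / 2; for |x| >= 2 the halved term is already 1. *)
Lemma min1_sqr_le x : Num.min 1 (x ^+ 2) <=
  2 / cos 1 ^+ 2 * (1 - cos x) + Num.min 1 ((x / 2) ^+ 2).
Proof.
have c1 := cos1_gt0 R.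
have K0 : 0 < 2 / cos 1 ^+ 2 :> R by rewrite divr_gt0// exprn_gt0.
have m0 : 0 <= Num.min 1 ((x / 2) ^+ 2) by rewrite le_min ler01 sqr_ge0.
have [x2|x2] := leP 1 `|x / 2|.
  have -> : Num.min 1 ((x / 2) ^+ 2) = 1.
    by apply/min_idPl; rewrite -real_normK ?num_real// exprn_ege1.
  by rewrite ge_min lerDr mulr_ge0 ?(ltW K0)// subr_ge0 cos_le1.
rewrite -[leLHS]addr0 lerD// ge_min; apply/orP; right.
rewrite -(cos_norm x) subr1_cos -(real_normK (num_real x)).
have h : 0 <= `|x| / 2 <= 1.
  by rewrite divr_ge0//=; move: x2; rewrite normrM [`|2^-1|]ger0_norm// => /ltW.
have := sin_ge_linear h; case/andP: h => h0 _ h.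
have h2 : cos 1 ^+ 2 * (`|x| / 2) ^+ 2 <= sin (`|x| / 2) ^+ 2.
  by rewrite -exprMn lerXn2r// nnegrE ?mulr_ge0// ?(ltW c1)// (le_trans _ h)// mulr_ge0// ltW.
have -> : 2 / cos 1 ^+ 2 * (2 * sin (`|x| / 2) ^+ 2) =
  4 * (sin (`|x| / 2) ^+ 2 / cos 1 ^+ 2) by ring.
have : (`|x| / 2) ^+ 2 <= sin (`|x| / 2) ^+ 2 / cos 1 ^+ 2.
  by rewrite ler_pdivlMr ?exprn_gt0// mulrC.
by rewrite expr_div_n; lra.
Qed.

(** For |x| <= 1/2 the first term is exactly |x|; beyond, 4 min(1, x^2) is at least 1. *)
Lemma min1_norm_le x : Num.min 1 `|x| <=
  2^-1 * Num.min 1 `|2 * x| + 4 * Num.min 1 (x ^+ 2).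
Proof.
rewrite normrM [`|2|]ger0_norm// -(real_normK (num_real x)).
by move: `|x| (normr_ge0 x) => y y0; rewrite !minEle; repeat case: ifP; nra.
Qed.

Lemma subr1_cos_min x t : t != 0 -> 1 - cos x <=
  2 * (1 < `|t * x|)%R%:R + t ^- 2 / 2 * Num.min 1 ((t * x) ^+ 2).
Proof.
move=> t0; have [tx|tx] := ltP 1 `|t * x|.
  have : 0 <= t ^- 2 / 2 * Num.min 1 ((t * x) ^+ 2).
    by rewrite mulr_ge0// ?divr_ge0 ?invr_ge0 ?sqr_ge0// le_min ler01 sqr_ge0.
  by rewrite mulr1; have := cos_geN1 x; lra.
have -> : Num.min 1 ((t * x) ^+ 2) = (t * x) ^+ 2.
  by apply/min_idPr; rewrite -real_normK ?num_real// exprn_ile1.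
rewrite mulr0 add0r.
have -> : t ^- 2 / 2 * (t * x) ^+ 2 = x ^+ 2 / 2 by field.
exact: subr1_cos_le.
Qed.

End trigonometry.

Lemma normr_min1_le (R : realDomainType) (y : R) : 0 <= y -> `|Num.min 1 y| <= 1.
Proof.
by move=> y0; rewrite ger0_norm ?le_min ?ler01// ge_min lexx.
Qed.

Lemma measurable_lt d (T : measurableType d) (R : realType) (f g : T -> R) :
  measurable_fun setT f -> measurable_fun setT g ->
  measurable [set w | f w < g w].
Proof.
move=> mf mg; have := measurable_fun_ltr mf mg measurableT (I : measurable [set true]).
by rewrite setTI.
Qed.

Section probability_tools.
Context d (T : measurableType d) (R : realType) (P : probability T R).
Implicit Types (A B : set T) (f g : T -> R).

Definition pr A : R := fine (P A).

Lemma prE A : measurable A -> P A = (pr A)%:E.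
Proof. by move=> mA; rewrite /pr fineK// fin_num_measure. Qed.

Lemma pr_ge0 A : 0 <= pr A. Proof. exact: fine_ge0. Qed.

Lemma le_pr A B : measurable A -> measurable B -> A `<=` B -> pr A <= pr B.
Proof.
by move=> mA mB AB; rewrite -lee_fin -!prE// le_measure// inE.
Qed.

Lemma pr_le1 A : measurable A -> pr A <= 1.
Proof. by move=> mA; rewrite -lee_fin -prE// probability_le1. Qed.

Lemma prC A : measurable A -> pr (~` A) = 1 - pr A.
Proof.
move=> mA; apply: EFin_inj; rewrite -prE ?probability_setC ?prE//.
exact: measurableC.
Qed.

Lemma prU_le A B : measurable A -> measurable B -> pr (A `|` B) <= pr A + pr B.
Proof.
move=> mA mB; rewrite -lee_fin EFinD -!prE//; last exact: measurableU.
exact: measureU2.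
Qed.

Lemma pr_cvg0 (F : nat -> set T) : (forall n, measurable (F n)) ->
  (forall m n, (m <= n)%N -> F n `<=` F m) -> \bigcap_n F n = set0 ->
  forall e, 0 < e -> exists n, pr (F n) < e.
Proof.
move=> mF dF F0 e e0.
have : P \o F @ \oo --> P (\bigcap_n F n).
  apply: nonincreasing_cvg_mu => //.
  - by rewrite ltey_eq fin_num_measure.
  - exact: bigcap_measurable.
  - by move=> m n mn; apply/subsetPset; exact: dF.
rewrite F0 measure0 => /fine_cvgP[_] /cvgrPdist_lt/(_ _ e0)[n _ /(_ n (leqnn _))].
by rewrite sub0r normrN ger0_norm ?pr_ge0// => ?; exists n.
Qed.

Lemma bounded_integrable f M : measurable_fun setT f ->
  (forall w, `|f w| <= M) -> P.-integrable setT (EFin \o f).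
Proof.
move=> mf fM; apply: measurable_bounded_integrable => //.
  by rewrite ltey_eq fin_num_measure.
exists M; split; first exact: num_real.
by move=> y My w _; apply: le_trans (fM w) _; exact: ltW.
Qed.

Lemma Rintegral_pr A : measurable A -> \int[P]_w (\1_A w) = pr A.
Proof. by move=> mA; rewrite /Rintegral integral_indic// setIT. Qed.

Lemma Rintegral_cst1 (r : R) : \int[P]_w r = r.
Proof. by rewrite Rintegral_cst//= [X in fine X](probability_setT P) mulr1. Qed.

End probability_tools.

Section truncated_moments.
Context d (T : measurableType d) (R : realType) (P : probability T R).
Context (X : T -> R) (mX : measurable_fun setT X).

Definition trunc_moment2 t := \int[P]_w Num.min 1 ((t * X w) ^+ 2).
Definition trunc_moment1 t := \int[P]_w Num.min 1 `|t * X w|.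
Definition charf_defect t := \int[P]_w (1 - cos (t * X w)).

Let mtX t : measurable_fun setT (fun w => t * X w).
Proof. exact: measurable_funM. Qed.

Let m2 t : measurable_fun setT (fun w => Num.min 1 ((t * X w) ^+ 2)).
Proof. by apply: measurable_minr => //; exact: measurable_funX. Qed.

Let m1 t : measurable_fun setT (fun w => Num.min 1 `|t * X w|).
Proof. by apply: measurable_minr => //; exact: measurableT_comp. Qed.

Let mc t : measurable_fun setT (fun w => 1 - cos (t * X w)).
Proof.
apply: measurable_funB => //; apply: (@measurableT_comp _ _ _ _ _ _ (@cos R)) => //.
by apply: continuous_measurable_fun; exact: continuous_cos.
Qed.

Let mt t : measurable [set w | 1 < `|t * X w|].
Proof.
by apply: (measurable_lt (f := cst _)) => //; exact: measurableT_comp.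
Qed.

Let i2 t : P.-integrable setT (EFin \o (fun w => Num.min 1 ((t * X w) ^+ 2))).
Proof.
by apply: (@bounded_integrable _ _ _ _ _ 1) => // w; rewrite normr_min1_le// sqr_ge0.
Qed.

Let i1 t : P.-integrable setT (EFin \o (fun w => Num.min 1 `|t * X w|)).
Proof. by apply: (@bounded_integrable _ _ _ _ _ 1) => // w; rewrite normr_min1_le. Qed.

Let ic t : P.-integrable setT (EFin \o (fun w => 1 - cos (t * X w))).
Proof.
apply: (@bounded_integrable _ _ _ _ _ 2) => // w.
by rewrite ger0_norm ?subr_ge0 ?cos_le1//; have := cos_geN1 (t * X w); lra.
Qed.

Let it t : P.-integrable setT (EFin \o (fun w => \1_[set w | 1 < `|t * X w|] w : R)).
Proof.
apply: (@bounded_integrable _ _ _ _ _ 1) => //.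
  exact: measurable_indic.
by move=> w; rewrite ger0_norm// indicE; case: (_ \in _).
Qed.

Let iZ r (f : T -> R) : P.-integrable setT (EFin \o f) ->
  P.-integrable setT (EFin \o (fun w => r * f w)).
Proof. by move=> /(integrableZl measurableT r). Qed.

Let iD (f g : T -> R) : P.-integrable setT (EFin \o f) ->
  P.-integrable setT (EFin \o g) ->
  P.-integrable setT (EFin \o (fun w => f w + g w)).
Proof. by move=> fi gi; exact: (integrableD measurableT fi gi). Qed.

Lemma trunc_moment2_le t : trunc_moment2 t <=
  2 / cos 1 ^+ 2 * charf_defect t + trunc_moment2 (t / 2).
Proof.
rewrite -RintegralZl// -RintegralD//; last exact: iZ.
apply: le_Rintegral => //; first by apply: iD => //; exact: iZ.
by move=> w _; rewrite [t / 2 * _]mulrAC; exact: min1_sqr_le.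
Qed.

Lemma trunc_moment1_le t : trunc_moment1 t <=
  2^-1 * trunc_moment1 (2 * t) + 4 * trunc_moment2 t.
Proof.
rewrite -!RintegralZl// -RintegralD//; [|exact: iZ|exact: iZ].
apply: le_Rintegral => //; first by apply: iD; exact: iZ.
by move=> w _; rewrite -mulrA; exact: min1_norm_le.
Qed.

(** The frequency [s * t] is decoupled from the truncation level 1 / t: a small [s] makes the moment
    term negligible, so that the defect has to come from the tail. *)
Lemma charf_defect_le s t : t != 0 -> charf_defect (s * t) <=
  2 * pr P [set w | 1 < `|t * X w|] + s ^+ 2 / 2 * trunc_moment2 t.
Proof.
move=> t0; rewrite -Rintegral_pr// -!RintegralZl// -RintegralD//; [|exact: iZ|exact: iZ].
apply: le_Rintegral => //; first by apply: iD; exact: iZ.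
move=> w _; have [->|s0] := eqVneq s 0.
  rewrite !mul0r cos0 subrr expr0n !mul0r addr0 mulr_ge0//.
have -> : t * X w = s^-1 * (s * t * X w) by field.
have := @subr1_cos_min R (s * t * X w) s^-1; rewrite invr_eq0 => /(_ s0).
rewrite exprVn invrK indicE.
have -> // : (w \in [set w | 1 < `|t * X w|]) = (1 < `|s^-1 * (s * t * X w)|).
have -> : s^-1 * (s * t * X w) = t * X w by field.
by apply/idP/idP; rewrite inE.
Qed.

(** Dominated convergence by hand; it closes the halving iteration of [trunc_moment2_bound]. *)
Lemma trunc_moment2_cvg0 e : 0 < e ->
  exists2 s, 0 < s & forall t, 0 < t < s -> trunc_moment2 t < e.
Proof.
move=> e0.
pose A n := [set w | n.+1%:R < `|X w|].
have mA n : measurable (A n).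
  by apply: (measurable_lt (f := cst _)) => //; exact: measurableT_comp.
have dA m n : (m <= n)%N -> A n `<=` A m.
  by move=> mn w /=; apply: le_lt_trans; rewrite ler_nat.
have A0 : \bigcap_n A n = set0.
  apply/seteqP; split => // w /(_ (Num.truncn `|X w|) I) /=.
  by rewrite /A /= ltNge ltW// truncnS_gt.
have [n Fn] := pr_cvg0 P mA dA A0 (divr_gt0 e0 (ltr0Sn _ 1)).
have iA : P.-integrable setT (EFin \o (fun w => \1_(A n) w : R)).
  apply: (@bounded_integrable _ _ _ _ _ 1); first exact: measurable_indic.
  by move=> w; rewrite ger0_norm// indicE; case: (_ \in _).
have ie : P.-integrable setT (EFin \o (fun w : T => e / 2)).
  apply: (@bounded_integrable _ _ _ _ _ (e / 2)) => // w.
  by rewrite ger0_norm// divr_ge0// ltW.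
(* Off [A n] this makes t |X| less than both 1 and e / 2, so its square is less than e / 2. *)
exists (Num.min 1 (e / 2) / n.+1%:R).
  by rewrite divr_gt0// lt_min ltr01 divr_gt0.
move=> t /andP[t0 ts].
suff : trunc_moment2 t <= pr P (A n) + e / 2 by move: Fn; lra.
rewrite -Rintegral_pr// -[X in _ + X](Rintegral_cst1 P) -RintegralD//.
apply: le_Rintegral => //; first exact: iD.
move=> w _; rewrite indicE; have [wA|wA] := boolP (w \in A n).
  rewrite ge_min; apply/orP; left; rewrite lerDl divr_ge0// ltW//.
rewrite add0r ge_min; apply/orP; right.
have Xw : `|X w| <= n.+1%:R.
  by rewrite leNgt; apply/negP => h; move/negP : wA; apply; rewrite inE.
have : t * `|X w| < Num.min 1 (e / 2).
  apply: le_lt_trans (_ : t * n.+1%:R < _); first by rewrite ler_wpM2l// ltW.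
  by rewrite -ltr_pdivlMr.
rewrite lt_min => /andP[h1 h2].
rewrite -real_normK ?num_real// normrM (gtr0_norm t0).
have : 0 <= t * `|X w| by rewrite mulr_ge0// ltW.
by nra.
Qed.

End truncated_moments.

Lemma powR2_gt1 (R : realType) (r : R) : 0 < r -> 1 < 2 `^ r.
Proof.
move=> r0; rewrite -[ltLHS](_ : 1 `^ r = 1); last by rewrite powR1.
by rewrite gt0_ltr_powR ?nnegrE// ltr1n.
Qed.

(** * Dyadic iteration: moments and tails of order t^b *)

Section charf_asymptotics.
Context d (T : measurableType d) (R : realType) (P : probability T R).
Context (X : T -> R) (mX : measurable_fun setT X) (b : R).
Hypothesis b02 : 0 < b < 2.

Let b0 : 0 < b. Proof. by case/andP: b02. Qed.

(** Only real parts are compared. The leading term [main] is left general because that of the bonds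
    has a complex coefficient, whose real part is c cos(pi gamma / 2). *)
Lemma charf_defect_asymp (main : R -> R[i]) (k : R) : 0 < k ->
  (forall s, complex.Re (main s) = 1 - k * s `^ b) ->
  charf_expansion (charf P X) main (fun s => s `^ b) ->
  exists2 s0 : R, 0 < s0 & forall s : R, 0 < s < s0 ->
    k / 2 * s `^ b <= charf_defect P X s <= 2 * k * s `^ b.
Proof.
move=> k0 mainE /charf_expansionP/(_ (k / 2) (divr_gt0 k0 (ltr0Sn _ 1))).
move=> [s0 /= s00 H]; exists s0 => // s /andP[sp ss0].
have {}H : `|charf P X s - main s| <= (k / 2 * `|s `^ b|)%:C%C.
  by apply: H => //=; rewrite sub0r normrN gtr0_norm.
have := le_trans (normc_ge_Re _) H.
rewrite lecR raddfB/= mainE (ger0_norm (powR_ge0 _ _)).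
have -> : \int[P]_w cos (s * X w) = 1 - charf_defect P X s.
  have mc : measurable_fun setT (fun w => cos (s * X w)).
    apply: (@measurableT_comp _ _ _ _ _ _ (@cos R)); last exact: measurable_funM.
    by apply: continuous_measurable_fun; exact: continuous_cos.
  rewrite /charf_defect RintegralB ?Rintegral_cst1; first by ring.
  - by [].
  - by apply: (@bounded_integrable _ _ _ _ _ 1) => // w; rewrite normr1.
  - by apply: (@bounded_integrable _ _ _ _ _ 1) => // w; rewrite cos_max.
have := powR_ge0 s b.
by rewrite ler_norml => sb0 /andP[h1 h2]; apply/andP; split; nra.
Qed.

Context (c1 c2 s0 : R).
Hypotheses (c1_gt0 : 0 < c1) (s0_gt0 : 0 < s0).
Hypothesis defectP : forall s : R, 0 < s < s0 ->
  c1 * s `^ b <= charf_defect P X s <= c2 * s `^ b.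

Let charf_defect_le2 s : charf_defect P X s <= 2.
Proof.
rewrite -[leRHS](Rintegral_cst1 P); apply: le_Rintegral => //.
- apply: (@bounded_integrable _ _ _ _ _ 2) => [|w].
    apply: measurable_funB => //.
    apply: (@measurableT_comp _ _ _ _ _ _ (@cos R)); last exact: measurable_funM.
    by apply: continuous_measurable_fun; exact: continuous_cos.
  by rewrite ger0_norm ?subr_ge0 ?cos_le1//; have := cos_geN1 (s * X w); lra.
- by apply: (@bounded_integrable _ _ _ _ _ 2) => // w; rewrite ger0_norm.
- by move=> w _; have := cos_geN1 (s * X w); lra.
Qed.

Let c2_gt0 : 0 < c2.
Proof.
have h : 0 < s0 / 2 < s0 by rewrite divr_gt0//= gtr_pMr// invf_lt1// ltr1n.
have p : 0 < (s0 / 2) `^ b by rewrite powR_gt0//; case/andP: h.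
have /andP[h1 h2] := defectP h.
have h3 : 0 < c1 * (s0 / 2) `^ b by rewrite mulr_gt0.
by rewrite -(pmulr_lgt0 _ p); apply: lt_le_trans h3 (le_trans h1 h2).
Qed.

(** Iterating [trunc_moment2_le] over t, t/2, t/4, ... sums the defects along a geometric series of
    ratio 2^(-b), and the remainder tends to 0. *)
Lemma trunc_moment2_bound :
  exists2 D : R, 0 < D & forall t : R, 0 < t -> trunc_moment2 P X t <= D * t `^ b.
Proof.
have [K K0 step] : exists2 K : R, 0 < K & forall t, trunc_moment2 P X t <=
    K * charf_defect P X t + trunc_moment2 P X (t / 2).
  exists (2 / cos 1 ^+ 2); last by move=> t; exact: trunc_moment2_le.
  by rewrite divr_gt0// exprn_gt0// cos1_gt0.
(* The second summand extends the bound on the defect to t >= s0, where the trivial bound 2 is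
   used. *)
pose C := c2 + 2 / s0 `^ b.
have s0b : 0 < s0 `^ b by rewrite powR_gt0.
have C0 : 0 < C by rewrite addr_gt0// divr_gt0.
have defC t : 0 < t -> charf_defect P X t <= C * t `^ b.
  move=> t0; have tb : 0 < t `^ b by rewrite powR_gt0.
  have [ts|st] := ltP t s0.
    have /defectP/andP[_ h] : 0 < t < s0 by rewrite t0.
    rewrite (le_trans h)// ler_wpM2r ?(ltW tb)// lerDl.
    by rewrite divr_ge0// ltW.
  rewrite (le_trans (charf_defect_le2 t))//.
  have h : s0 `^ b <= t `^ b by rewrite ge0_ler_powR ?nnegrE// ltW.
  have : 2 <= 2 / s0 `^ b * t `^ b by rewrite mulrAC ler_pdivlMr// ler_wpM2l.
  by have := mulr_gt0 c2_gt0 tb; rewrite /C mulrDl; lra.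
pose q : R := 2 `^ (- b).
have q01 : 0 < q < 1.
  by rewrite powR_gt0//= /q powRN invf_lt1 ?powR_gt0// powR2_gt1.
case/andP: q01 => q0 q1.
have qE t : 0 <= t -> (t / 2) `^ b = q * t `^ b.
  move=> t0; rewrite powRM// mulrC; congr (_ * _).
  by rewrite /q -powR_inv1// -powRrM mulN1r.
(* With this [D], the sum of the geometric series, each halving step telescopes. *)
have [D D0 DE] : exists2 D : R, 0 < D & K * C = D - D * q.
  exists (K * C / (1 - q)); last by field; rewrite gt_eqF// subr_gt0.
  by apply: divr_gt0; [exact: mulr_gt0|rewrite subr_gt0].
exists D => // t t0.
have iter n : trunc_moment2 P X t <=
    trunc_moment2 P X (t / 2 ^+ n) + D * t `^ b - D * (t / 2 ^+ n) `^ b.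
  elim: n => [|n IH]; first by rewrite expr0 divr1 addrK.
  apply: (le_trans IH).
  have u0 : 0 < t / 2 ^+ n by rewrite divr_gt0// exprn_gt0.
  have -> : t / 2 ^+ n.+1 = t / 2 ^+ n / 2 by rewrite exprSr invfM mulrA.
  move: (t / 2 ^+ n) u0 => u u0; rewrite (qE _ (ltW u0)).
  have := step u.
  have : K * charf_defect P X u <= (D - D * q) * u `^ b.
    by rewrite -DE -mulrA ler_pM2l// defC.
  lra.
(* By [iter], an excess over D t^b would be inherited by every t / 2^n, against
   [trunc_moment2_cvg0]. *)
rewrite leNgt; apply/negP => lt; rewrite -subr_gt0 in lt.
have [s sp hs] := trunc_moment2_cvg0 P mX lt.
pose n := (Num.truncn (t / s)).+1.
have tn : t / s < n%:R by rewrite truncnS_gt.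
have n2 : n%:R <= 2 ^+ n :> R by rewrite -natrX ler_nat ltnW// ltn_expl.
have : 0 < t / 2 ^+ n < s.
  rewrite divr_gt0 ?exprn_gt0//= ltr_pdivrMr ?exprn_gt0// mulrC -ltr_pdivrMr//.
  exact: lt_le_trans n2.
move=> /hs; have := iter n; have := powR_ge0 (t / 2 ^+ n) b; nra.
Qed.

(** At frequency e t the defect is at least of order e^b t^b, whereas the truncated second moment
    contributes at most of order e^2 t^b. As b < 2, a small e leaves a positive share to the
    tail. *)
Lemma tail_ge : exists2 c : R, 0 < c & exists2 t0 : R, 0 < t0 &
  forall t : R, 0 < t < t0 -> c * t `^ b <= pr P [set w | 1 < `|t * X w|].
Proof.
have [D D0 HD] := trunc_moment2_bound.
pose r := 2 - b; have r0 : 0 < r by rewrite subr_gt0; case/andP: b02.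
(* With this [e], the truncated second moment is at most half of the defect. *)
pose e := Num.min 1 ((c1 / D) `^ r^-1).
have e0 : 0 < e by rewrite lt_min ltr01 powR_gt0// divr_gt0.
have er : e `^ r <= c1 / D.
  have -> : c1 / D = ((c1 / D) `^ r^-1) `^ r.
    by rewrite -powRrM mulVf ?gt_eqF// powRr1// ltW// divr_gt0.
  rewrite ge0_ler_powR ?nnegrE ?powR_ge0 ?(ltW e0) ?(ltW r0)//.
  by rewrite /e ge_min lexx orbT.
have e2 : e ^+ 2 = e `^ b * e `^ r.
  rewrite -powRD; last by rewrite (gt_eqF e0) implybT.
  by rewrite /r addrC subrK powR_mulrn// ltW.
exists (c1 / 4 * e `^ b); first by rewrite mulr_gt0 ?powR_gt0// divr_gt0.
exists (s0 / e); first by rewrite divr_gt0.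
move=> t /andP[t0 ts].
have eb0 : 0 < e `^ b by rewrite powR_gt0.
have tb0 : 0 < t `^ b by rewrite powR_gt0.
have /defectP/andP[h _] : 0 < e * t < s0.
  by rewrite mulr_gt0//= mulrC -ltr_pdivlMr.
have := charf_defect_le P mX e (lt0r_neq0 t0).
move: h; rewrite powRM ?(ltW t0) ?(ltW e0)// e2 => h1 h2.
have h3 := HD _ t0.
have h4 : e `^ r * trunc_moment2 P X t <= c1 * t `^ b.
  apply: (le_trans (ler_wpM2l (powR_ge0 _ _) h3)).
  rewrite mulrA ler_wpM2r ?(ltW tb0)//.
  by rewrite -ler_pdivlMr.
have h5 : e `^ b * (e `^ r * trunc_moment2 P X t) <= e `^ b * (c1 * t `^ b).
  by rewrite ler_wpM2l// ltW.
nra.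
Qed.

Lemma trunc_moment1_le1 t : trunc_moment1 P X t <= 1.
Proof.
rewrite -[leRHS](Rintegral_cst1 P); apply: le_Rintegral => //.
- apply: (@bounded_integrable _ _ _ _ _ 1) => [|w].
    apply: measurable_minr => //; apply: measurableT_comp => //.
    exact: measurable_funM.
  exact: normr_min1_le.
- by apply: (@bounded_integrable _ _ _ _ _ 1) => // w; rewrite ger0_norm.
Qed.

Lemma trunc_moment1_mono s t : 0 <= s <= t ->
  trunc_moment1 P X s <= trunc_moment1 P X t.
Proof.
move=> /andP[s_ge0 st]; apply: le_Rintegral => //.
- apply: (@bounded_integrable _ _ _ _ _ 1) => [|w]; last exact: normr_min1_le.
  apply: measurable_minr => //; apply: measurableT_comp => //.
  exact: measurable_funM.
- apply: (@bounded_integrable _ _ _ _ _ 1) => [|w]; last exact: normr_min1_le.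
  apply: measurable_minr => //; apply: measurableT_comp => //.
  exact: measurable_funM.
move=> w _; rewrite le_min2// !normrM ler_wpM2r// ger0_norm// (le_trans st)//.
exact: ler_norm.
Qed.

Let expV2_lt (t : R) : 0 < t -> exists n, 2 ^- n <= t.
Proof.
move=> t0; exists (Num.truncn t^-1).+1.
rewrite invf_ple ?posrE ?exprn_gt0//.
apply: le_trans (ltW (truncnS_gt _)) _.
by rewrite -natrX ler_nat ltnW// ltn_expl.
Qed.

Let expV2_double n (t : R) : 2 ^- n.+1 <= t -> 2 ^- n <= 2 * t.
Proof. by rewrite exprS invfM => h; rewrite -ler_pdivrMl. Qed.

(** [trunc_moment1_le] is iterated upwards, doubling t until it reaches 1, where the bound is
    trivial. As 2^b / 2 < 1, the form K t^b reproduces itself. *)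
Lemma trunc_moment1_bound_lt1 : b < 1 ->
  exists2 D : R, 0 < D & forall t : R, 0 < t -> trunc_moment1 P X t <= D * t `^ b.
Proof.
move=> b1; have [D D0 HD] := trunc_moment2_bound.
have p2 : 2 `^ b < 2 :> R.
  have -> : 2 `^ b = 2 / 2 `^ (1 - b) :> R.
    rewrite powRD; last by rewrite pnatr_eq0 implybT.
    by rewrite powRr1// powRN invfM invrK mulrA divff// mul1r.
  by rewrite ltr_pdivrMr ?powR_gt0// ltr_pMr// powR2_gt1// subr_gt0.
(* Chosen so that K 2^b / 2 + 4 D <= K, with K >= 1 for the base case. *)
pose K := 1 + 4 * D / (1 - 2 `^ b / 2).
have d0 : 0 < 1 - 2 `^ b / 2 :> R by lra.
have K1 : 1 <= K by rewrite lerDl divr_ge0// ltW// mulr_gt0.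
have KE : 4 * D <= K * (1 - 2 `^ b / 2).
  by rewrite /K [leRHS]mulrDl mul1r divfK ?gt_eqF// lerDr ltW.
exists K; first exact: lt_le_trans K1.
move=> t t0; have [n] := expV2_lt t0.
elim: n t t0 => [|n IH] t t0.
  rewrite expr0 invr1 => t1; rewrite (le_trans (trunc_moment1_le1 _))//.
  rewrite -[leLHS]mulr1 ler_pM// -[leLHS](powRr0 t).
  by rewrite ler_powR// ltW.
move=> /expV2_double/IH; rewrite mulr_gt0// => /(_ isT).
have := HD _ t0; have := trunc_moment1_le P mX t.
rewrite powRM ?(ltW t0)//; have := powR_gt0 b t0.
by move: KE; move: (2 `^ b) (t `^ b) => p u; nra.
Qed.

Lemma trunc_moment1_bound_gt1 : 1 < b ->
  exists2 D : R, 0 < D & forall t : R, 0 < t -> trunc_moment1 P X t <= D * t.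
Proof.
move=> b1; have [D D0 HD] := trunc_moment2_bound.
have p2 : 2 < 2 `^ b :> R.
  have -> : 2 `^ b = 2 * 2 `^ (b - 1) :> R.
    rewrite powRD; last by rewrite pnatr_eq0 implybT.
    by rewrite mulrC powRN powRr1// divfK.
  by rewrite ltr_pMr// powR2_gt1// subr_gt0.
pose K := 4 * D / (2 `^ b / 2 - 1).
have d0 : 0 < 2 `^ b / 2 - 1 :> R by lra.
have K0 : 0 < K by rewrite divr_gt0// mulr_gt0.
have KE : 4 * D = K * (2 `^ b / 2 - 1) by rewrite /K divfK ?gt_eqF.
exists (2 + 2 * K); first by rewrite addr_gt0// mulr_gt0.
move=> t t0; have [t1|t1] := leP t 1; last first.
  by rewrite (le_trans (trunc_moment1_le1 _))//; nra.
(* A bound linear in t is not preserved by the recursion; subtracting K t^b absorbs the term 4 D t^b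
   exactly. The constant 2 + 2 K makes the right side at least 1 on [1/2, 1]. *)
suff : trunc_moment1 P X t <= (2 + 2 * K) * t - K * t `^ b.
  by have := powR_ge0 t b; nra.
have [n] := expV2_lt t0.
elim: n t t0 t1 => [|n IH] t t0 t1 tn.
  have -> : t = 1 by apply/le_anti; rewrite t1; move: tn; rewrite expr0 invr1.
  by rewrite powR1 (le_trans (trunc_moment1_le1 _))//; lra.
have [t2|t2] := leP t 2^-1; last first.
  rewrite (le_trans (trunc_moment1_le1 _))//.
  have : t `^ b <= 1 `^ b by rewrite ge0_ler_powR ?nnegrE// ltW.
  by rewrite powR1; nra.
have := IH (2 * t); rewrite mulr_gt0// => /(_ isT).
have -> : 2 * t <= 1 by lra.
move=> /(_ isT (expV2_double tn)).
have := HD _ t0; have := trunc_moment1_le P mX t.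
rewrite powRM ?(ltW t0)//; have := powR_gt0 b t0.
by move: KE; move: (2 `^ b) (t `^ b) => p u; nra.
Qed.

Lemma trunc_moment1_bound_eq1 : b = 1 -> exists2 D : R, 0 < D &
  forall t : R, 0 < t <= 1 -> trunc_moment1 P X t <= D * t * (1 - ln t).
Proof.
move=> b1; have [D D0 HD] := trunc_moment2_bound.
have l2 : 0 < ln 2 :> R by rewrite ln_gt0// ltr1n.
pose K := 4 * D / ln 2.
have K0 : 0 < K by rewrite divr_gt0// mulr_gt0.
have KE : 4 * D = K * ln 2 by rewrite /K divfK ?gt_eqF.
exists (2 + K); first by rewrite addr_gt0.
move=> t /andP[t0 t1].
(* Each doubling costs 4 D t = K t ln 2, which is the change of the logarithmic term. *)
suff : trunc_moment1 P X t <= 2 * t - K * t * ln t.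
  have := ln_le0 t1; have : 0 < K * t by rewrite mulr_gt0.
  by nra.
have [n] := expV2_lt t0.
elim: n t t0 t1 => [|n IH] t t0 t1 tn.
  have -> : t = 1 by apply/le_anti; rewrite t1; move: tn; rewrite expr0 invr1.
  by rewrite ln1 (le_trans (trunc_moment1_le1 _))//; lra.
have [t2|t2] := leP t 2^-1; last first.
  rewrite (le_trans (trunc_moment1_le1 _))//.
  have := ln_le0 t1; have : 0 < K * t by rewrite mulr_gt0.
  by nra.
have := IH (2 * t); rewrite mulr_gt0// => /(_ isT).
have -> : 2 * t <= 1 by lra.
move=> /(_ isT (expV2_double tn)).
have := HD _ t0; have := trunc_moment1_le P mX t.
rewrite b1 powRr1 ?(ltW t0)// lnM ?posrE//.
have -> : 2 * t - K * t * ln t =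
  2^-1 * (2 * (2 * t) - K * (2 * t) * (ln 2 + ln t)) + 4 * D * t by rewrite KE; field.
lra.
Qed.

End charf_asymptotics.

(** * Persistence of a symmetric random walk *)

Section countable_conditioning.
Context d (T : measurableType d) (R : realType) (P : probability T R).
Context (C : countType).

(** Level sets of [X] indexed by codes in [nat], empty for a number that codes nothing, so that
    countable additivity applies to an ordinary series. *)
Definition fiber (X : T -> C) (n : nat) : set T :=
  if pickle_inv n is Some c then X @^-1` [set c] else set0.

Lemma fiberP (X : T -> C) w : fiber X (pickle (X w)) w.
Proof. by rewrite /fiber pickleK_inv. Qed.

Lemma fiber_pickle (X : T -> C) n w : fiber X n w -> pickle (X w) = n.
Proof.
rewrite /fiber; have := @pickle_invK C n.
by case: (pickle_inv n) => // c <- /= ->.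
Qed.

Let trivIset_fiber (X : T -> C) D : trivIset setT (fun n => D `&` fiber X n).
Proof.
apply/trivIsetP => i j _ _; apply: contraNeq => /set0P.
by case=> w [[_ /fiber_pickle<-] [_ /fiber_pickle<-]].
Qed.

Let bigcup_fiber (X : T -> C) D : \bigcup_n (D `&` fiber X n) = D.
Proof.
apply/seteqP; split => w; first by case=> n _ [].
by move=> Dw; exists (pickle (X w)) => //; split => //; exact: fiberP.
Qed.

Lemma measurable_fiber (X : T -> C) : (forall c, measurable (X @^-1` [set c])) ->
  forall n, measurable (fiber X n).
Proof. by move=> mX n; rewrite /fiber; case: pickle_inv. Qed.

Lemma measurable_countable_preimage (X : T -> C) A :
  (forall c, measurable (X @^-1` [set c])) -> measurable (X @^-1` A).
Proof.
move=> mX; rewrite -(bigcup_fiber X (X @^-1` A)).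
apply: bigcupT_measurable => n; rewrite /fiber.
case: pickle_inv => [c|]; last by rewrite setI0.
have [Ac|nAc] := pselect (A c).
  by rewrite (_ : _ `&` _ = X @^-1` [set c])//; apply/seteqP; split => [w []//|w /= ->].
rewrite (_ : _ `&` _ = set0)//; apply/seteqP; split => // w [] /= + Xc.
by rewrite Xc.
Qed.

Local Open Scope ereal_scope.

(** The elementary substitute for conditional expectation. Two variables are allowed, so that it
    serves both for conditioning ([X] and [X'] equal) and for comparing two families with the same
    law. *)
Lemma le_integral_fibers (X X' : T -> C) (D D' : set T) (f g : T -> \bar R) (k : R) :
  (forall c, measurable (X @^-1` [set c])) ->
  (forall c, measurable (X' @^-1` [set c])) ->
  measurable D -> measurable D' ->
  measurable_fun setT f -> measurable_fun setT g ->
  (forall w, 0 <= f w) -> (forall w, 0 <= g w) ->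
  (forall c, \int[P]_(w in D `&` X @^-1` [set c]) f w <=
     k%:E * \int[P]_(w in D' `&` X' @^-1` [set c]) g w) ->
  \int[P]_(w in D) f w <= k%:E * \int[P]_(w in D') g w.
Proof.
move=> mX mX' mD mD' mf mg f0 g0 fg.
rewrite -[X in integral _ X f](bigcup_fiber X) -[X in integral _ X g](bigcup_fiber X').
rewrite !ge0_integral_bigcup//; last 4 first.
- by move=> n; apply: measurableI => //; exact: measurable_fiber.
- exact: measurable_funS mg.
- by move=> n; apply: measurableI => //; exact: measurable_fiber.
- exact: measurable_funS mf.
rewrite -nneseriesZl; last by move=> i _; exact: integral_ge0.
apply: lee_nneseries => [i _ _|n _]; first exact: integral_ge0.
rewrite /fiber; case: pickle_inv => [c|]; first exact: fg.
by rewrite !setI0 !integral_set0 mule0.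
Qed.

Local Close Scope ereal_scope.

Lemma le_pr_fibers (X X' : T -> C) (D D' : set T) (k : R) :
  (forall c, measurable (X @^-1` [set c])) ->
  (forall c, measurable (X' @^-1` [set c])) ->
  measurable D -> measurable D' ->
  (forall c, pr P (D `&` X @^-1` [set c]) <= k * pr P (D' `&` X' @^-1` [set c])) ->
  pr P D <= k * pr P D'.
Proof.
move=> mX mX' mD mD' DD'.
rewrite -lee_fin EFinM -!prE// -[P D]mul1e -[P D']mul1e.
rewrite -!(integral_cst P)//.
apply: (le_integral_fibers mX mX') => // c.
have m1 := measurableI _ _ mD (mX c); have m2 := measurableI _ _ mD' (mX' c).
rewrite !integral_cst// !mul1e.
by have := DD' c; rewrite -lee_fin EFinM -!prE.
Qed.

Lemma eq_pr_fibers (X X' : T -> C) (D D' : set T) (k : R) :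
  (forall c, measurable (X @^-1` [set c])) ->
  (forall c, measurable (X' @^-1` [set c])) ->
  measurable D -> measurable D' -> 0 <= k ->
  (forall c, pr P (D `&` X @^-1` [set c]) = k * pr P (D' `&` X' @^-1` [set c])) ->
  pr P D = k * pr P D'.
Proof.
move=> mX mX' mD mD' k0 DD'; apply/le_anti/andP; split.
  by apply: (le_pr_fibers mX mX') => // c; rewrite DD'.
case: (ltgtP 0 k) k0 => // [k0 _|<- _]; last by rewrite mul0r pr_ge0.
rewrite -ler_pdivlMl//; apply: (le_pr_fibers mX' mX) => // c.
by rewrite DD' mulKf// gt_eqF.
Qed.

Lemma preimageI1 (X : T -> C) A c :
  X @^-1` A `&` X @^-1` [set c] = if `[< A c >] then X @^-1` [set c] else set0.
Proof.
case: asboolP => [Ac|nAc]; apply/seteqP; split => w //=; first by case.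
- by move=> ->.
- by case=> + wc; rewrite wc.
Qed.

Lemma pr_indep_fibers (X : T -> C) (E : set T) (A : set C) :
  (forall c, measurable (X @^-1` [set c])) -> measurable E ->
  (forall c, pr P (X @^-1` [set c] `&` E) = pr P (X @^-1` [set c]) * pr P E) ->
  pr P (X @^-1` A `&` E) = pr P (X @^-1` A) * pr P E.
Proof.
move=> mX mE XE; rewrite mulrC; have mA := measurable_countable_preimage A mX.
apply: (eq_pr_fibers mX mX) => //; [exact: measurableI|exact: pr_ge0|move=> c].
rewrite setIAC preimageI1; case: ifP => _; first by rewrite XE mulrC.
by rewrite set0I /pr measure0 mulr0.
Qed.

End countable_conditioning.

Definition psum (s : seq int) (k : nat) : int := \sum_(z <- take k s) z.
(** Path events are coded as sets of step lists: shifting, reversing or negating a block of steps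
    then becomes a change of list, to which exchangeability and symmetry apply. *)
Definition nonpos_sums : set (seq int) :=
  [set s | forall k, (0 < k <= size s)%N -> psum s k <= 0].
Definition neg_sums : set (seq int) :=
  [set s | forall k, (0 < k <= size s)%N -> psum s k < 0].

(** * First-maximum decomposition and the order of the persistence probability *)

Section fluctuation.
Context d (T : measurableType d) (R : realType) (P : probability T R).
Context (xi : nat -> T -> int).
Hypothesis mxi : forall k, measurable_fun setT (xi k).
Hypothesis xi_indep : mutually_independent P xi.
Hypothesis xi_ident : identically_distributed P xi.

Local Notation S := (walk xi).

Definition steps (J : seq nat) (w : T) : seq int := [seq xi j w | j <- J].

Lemma measurable_step k A : measurable (xi k @^-1` A).
Proof. by rewrite -[X in measurable X]setTI; exact: mxi. Qed.

Lemma measurable_steps1 J v : measurable (steps J @^-1` [set v]).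
Proof.
elim: J v => [|j J IH] [|z v].
- by rewrite (_ : _ @^-1` _ = setT)//; apply/seteqP; split.
- by rewrite (_ : _ @^-1` _ = set0)//; apply/seteqP; split.
- by rewrite (_ : _ @^-1` _ = set0)//; apply/seteqP; split.
rewrite (_ : _ @^-1` _ = xi j @^-1` [set z] `&` steps J @^-1` [set v]).
  by apply: measurableI => //; exact: measurable_step.
by apply/seteqP; split => w /= [-> ->].
Qed.

Lemma measurable_steps J A : measurable (steps J @^-1` A).
Proof. by apply: measurable_countable_preimage => v; exact: measurable_steps1. Qed.

Lemma pr_steps1 J v : uniq J -> size v = size J ->
  pr P (steps J @^-1` [set v]) = \prod_(z <- v) pr P (xi 0%N @^-1` [set z]).
Proof.
move=> uJ sv; pose A (j : nat) : set int := [set nth 0 v (index j J)].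
have vE : v = [seq nth 0 v (index j J) | j <- J].
  apply: (@eq_from_nth _ 0); first by rewrite size_map.
  move=> i iv; rewrite (nth_map 0%N) -?sv// index_uniq// -?sv//.
have stepsE : steps J @^-1` [set v] = \bigcap_(j in [set` J]) (xi j @^-1` A j).
  apply/seteqP; split => w /=.
    move=> wv j /= jJ.
    by rewrite /A /= -wv /steps (nth_map 0%N) ?index_mem// nth_index.
  by move=> H; rewrite [RHS]vE; apply/eq_in_map => j /H.
apply: EFin_inj; rewrite -prE; last exact: measurable_steps1.
rewrite stepsE xi_indep// vE big_map.
rewrite (eq_bigr (fun j => (pr P (xi 0%N @^-1` A j))%:E)); last first.
  by move=> j _; rewrite (xi_ident j 0%N)// prE//; exact: measurable_step.
have prodE (F : nat -> R) K : (\prod_(j <- K) (F j)%:E)%E = (\prod_(j <- K) F j)%:E.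
  by elim: K => [|j K IH]; rewrite ?big_nil// !big_cons IH EFinM.
exact: (prodE (fun j => pr P (xi 0%N @^-1` A j))).
Qed.

(** Both laws are the same product of one-step laws. This gives invariance under time shift and,
    with a reversed list of indices, under time reversal. *)
Lemma pr_steps_eq J J' A : uniq J -> uniq J' -> size J = size J' ->
  pr P (steps J @^-1` A) = pr P (steps J' @^-1` A).
Proof.
move=> uJ uJ' sJ; rewrite -[RHS]mul1r.
apply: (eq_pr_fibers (measurable_steps1 J) (measurable_steps1 J')) => //.
- exact: measurable_steps.
- exact: measurable_steps.
move=> v; rewrite !preimageI1 mul1r; case: ifP => // _.
have [sv|sv] := eqVneq (size v) (size J); first by rewrite !pr_steps1// -?sJ.
have H K : size v != size K -> steps K @^-1` [set v] = set0.
  by move=> vK; apply/seteqP; split => // w /= wv; rewrite -wv size_map eqxx in vK.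
by rewrite !H// -sJ.
Qed.

Lemma pr_steps_indep J J' A B : uniq (J ++ J') ->
  pr P (steps J @^-1` A `&` steps J' @^-1` B) =
  pr P (steps J @^-1` A) * pr P (steps J' @^-1` B).
Proof.
move=> uJJ'; have /and3P[uJ _ uJ'] : [&& uniq J, true & uniq J'].
  by move: uJJ'; rewrite cat_uniq => /and3P[-> _ ->].
apply: pr_indep_fibers => [v||v]; [exact: measurable_steps1|exact: measurable_steps|].
rewrite setIC mulrC.
apply: pr_indep_fibers => [u||u]; [exact: measurable_steps1|exact: measurable_steps1|].
have S0 K x : size x != size K -> steps K @^-1` [set x] = set0.
  by move=> xK; apply/seteqP; split => // w /= wx; rewrite -wx size_map eqxx in xK.
have [sv|sv] := eqVneq (size v) (size J); last first.
  by rewrite (S0 J v)// setI0 /pr measure0 mulr0.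
have [su|su] := eqVneq (size u) (size J'); last first.
  by rewrite (S0 J' u)// set0I /pr measure0 mul0r.
rewrite setIC (_ : _ `&` _ = steps (J ++ J') @^-1` [set v ++ u]).
  by rewrite !pr_steps1// ?size_cat ?sv ?su// big_cat mulrC.
apply/seteqP; split => w /=; rewrite /steps map_cat; first by case=> -> ->.
by move/eqP; rewrite eqseq_cat ?size_map// => /andP[/eqP -> /eqP ->].
Qed.

Lemma psum_steps m n i w : (i <= n)%N ->
  psum (steps (iota m n) w) i = S (m + i) w - S m w.
Proof.
move=> le_in; rewrite /psum /steps -map_take take_iota (minn_idPl le_in) big_map.
rewrite /walk -!(big_mkord xpredT (fun k => xi k w)).
rewrite (big_cat_nat (leq0n m) (leq_addr i m))/= addrAC subrr add0r.
by rewrite /index_iota addKn.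
Qed.

Lemma psum_rev_steps k i w : (i <= k)%N ->
  psum (map -%R (rev (steps (iota 0 k) w))) i = S (k - i) w - S k w.
Proof.
move=> le_ik; rewrite /psum -map_take big_map sumrN take_rev.
rewrite (perm_big (drop (size (steps (iota 0 k) w) - i) (steps (iota 0 k) w))); last first.
  by rewrite perm_rev.
rewrite size_map size_iota /steps -map_drop drop_iota add0n subKn//.
have := psum_steps (k - i) w (leqnn i).
rewrite /psum take_oversize ?size_map ?size_iota// => ->.
by rewrite subnK// opprB.
Qed.

Definition stay n : set T := steps (iota 0 n) @^-1` nonpos_sums.
(** These are a_n and, in [neg_prob], b_n of the overview. *)
Definition stay_prob n := pr P (stay n).
Definition neg_prob n := pr P (steps (iota 0 n) @^-1` neg_sums).

Lemma stayE n : stay n = [set w | forall j, (0 < j <= n)%N -> S j w <= 0].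
Proof.
apply/seteqP; split => w; rewrite /stay /nonpos_sums /= size_map size_iota.
  move=> H j jn; have := H j jn; case/andP: jn => _ jn.
  by rewrite psum_steps// add0n [S 0%N w]big_ord0 subr0.
move=> H j jn; have := H j jn; case/andP: jn => _ jn.
by rewrite psum_steps// add0n [S 0%N w]big_ord0 subr0.
Qed.

Lemma measurable_stay n : measurable (stay n).
Proof. exact: measurable_steps. Qed.

(** Stated through two disjoint blocks of steps so that it factorizes; [first_maxE] identifies it
    with the first maximum being at time k. The steps before k are read backwards from the
    maximum. *)
Definition first_max n k : set T :=
  (steps (iota 0 k) @^-1` [set s | neg_sums (map -%R (rev s))]) `&`
  (steps (iota k (n - k)) @^-1` nonpos_sums).

Lemma first_maxE n k : (k <= n)%N -> first_max n k =
  [set w | (forall j, (j < k)%N -> S j w < S k w) /\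
           (forall j, (k < j <= n)%N -> S j w <= S k w)].
Proof.
move=> kn; apply/seteqP; split => w /= [].
  rewrite /neg_sums /nonpos_sums /= size_map size_rev !size_map !size_iota => H1 H2.
  split=> j jk.
    have /H1 : (0 < k - j <= k)%N by rewrite subn_gt0 jk leq_subr.
    by rewrite psum_rev_steps ?leq_subr// subKn ?subr_lt0// ltnW.
  case/andP: jk => kj jn; have /H2 : (0 < j - k <= n - k)%N.
    by rewrite subn_gt0 kj leq_sub2r.
  by rewrite psum_steps ?leq_sub2r// subnKC ?subr_le0// ltnW.
move=> H1 H2; split;
  rewrite /neg_sums /nonpos_sums /= ?size_map ?size_rev ?size_map ?size_iota.
  move=> i /andP[i0 ik]; rewrite psum_rev_steps// subr_lt0; apply: H1.
  by rewrite ltn_subrL i0 (leq_trans i0).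
move=> i /andP[i0 ik]; rewrite psum_steps// subr_le0; apply: H2.
by rewrite -{1}[k]addn0 ltn_add2l i0 -leq_subRL.
Qed.

Hypothesis xi_sym : symmetric_law P (xi 0%N).

Lemma pr_steps_opp J A : uniq J ->
  pr P (steps J @^-1` [set s | A (map -%R s)]) = pr P (steps J @^-1` A).
Proof.
move=> uJ; pose X w := map -%R (steps J w).
have oppK (s : seq int) : map -%R (map -%R s) = s by rewrite mapK//; exact: opprK.
have X1 v : X @^-1` [set v] = steps J @^-1` [set map -%R v].
  by apply/seteqP; split => [w /= <-|w /= wE]; rewrite /X ?wE oppK.
have mX v : measurable (X @^-1` [set v]) by rewrite X1; exact: measurable_steps1.
rewrite -[RHS]mul1r -[X in pr P X](_ : X @^-1` A = _)//.
apply: (eq_pr_fibers mX (measurable_steps1 J)) => //.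
- exact: measurable_countable_preimage.
- exact: measurable_steps.
move=> v; rewrite !preimageI1 mul1r; case: ifP => // _; rewrite X1.
have [sv|sv] := eqVneq (size v) (size J).
  rewrite !pr_steps1 ?size_map// big_map; apply: eq_bigr => z _.
  by rewrite /pr -xi_sym.
have S0 x : size x != size J -> steps J @^-1` [set x] = set0.
  by move=> xK; apply/seteqP; split => // w /= wx; rewrite -wx size_map eqxx in xK.
by rewrite !S0// size_map.
Qed.

(** Exchangeability undoes the reversal, symmetry of the steps the change of sign. *)
Lemma first_max_prob n k : (k <= n)%N ->
  pr P (first_max n k) = neg_prob k * stay_prob (n - k).
Proof.
move=> kn; rewrite pr_steps_indep; last by rewrite -iotaD subnKC// iota_uniq.
congr (_ * _); last by apply: pr_steps_eq; rewrite ?iota_uniq// !size_iota.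
rewrite (_ : _ @^-1` _ = steps (rev (iota 0 k)) @^-1` [set s | neg_sums (map -%R s)]).
  rewrite pr_steps_opp ?rev_uniq ?iota_uniq//.
  by apply: pr_steps_eq; rewrite ?rev_uniq ?iota_uniq ?size_rev.
by apply/seteqP; split => w /=; rewrite /steps !map_rev.
Qed.

Lemma measurable_first_max n k : measurable (first_max n k).
Proof. by apply: measurableI; exact: measurable_steps. Qed.

Lemma first_max_cover n w : exists2 k, (k <= n)%N & first_max n k w.
Proof.
have ex : exists k, (k <= n)%N && [forall j : 'I_n.+1, S j w <= S k w].
  have [k _ kmax] := @Order.TotalTheory.arg_maxP _ _ _ (@ord0 n) xpredT
    (fun j : 'I_n.+1 => S j w) isT.
  by exists k; rewrite -ltnS ltn_ord; apply/forallP => j; exact: kmax.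
have [k /andP[kn /forallP kmax] kmin] := ex_minnP ex.
exists k => //; rewrite first_maxE//; split => j.
  move=> jk; have := kmax (Ordinal (leqW (leq_trans jk kn))) => /=.
  rewrite le_eqVlt => /predU1P[Sjk|//].
  suff : (k <= j)%N by rewrite leqNgt jk.
  apply: kmin; rewrite (leq_trans (ltnW jk) kn)/=; apply/forallP => i.
  by rewrite Sjk; exact: kmax.
by move=> /andP[_ jn]; exact: kmax (Ordinal (jn : (j < n.+1)%N)).
Qed.

Lemma first_max_uniq n k k' w : (k <= n)%N -> (k' <= n)%N ->
  first_max n k w -> first_max n k' w -> k = k'.
Proof.
wlog kk' : k k' / (k <= k')%N.
  move=> H kn k'n Hk Hk'; have [/H|/ltnW/H] := leqP k k'; first exact.
  by move=> ->.
move=> kn k'n; rewrite !first_maxE//= => -[_ H] [H' _].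
move: kk'; rewrite leq_eqVlt => /predU1P[//|kk'].
have := H k'; rewrite kk' k'n => /(_ isT).
by rewrite leNgt H'.
Qed.

(* The walk has exactly one first maximum on [0, n]; reversing the time before
   it turns the first factor into an avoidance probability as well. *)
Lemma first_max_decomposition n :
  \sum_(k < n.+1) neg_prob k * stay_prob (n - k) = 1.
Proof.
have H : P (\big[setU/set0]_(k < n.+1) first_max n k) =
    (\sum_(k < n.+1) P (first_max n k))%E.
  apply: (@measure_bigsetU_ord _ _ _ _ _ xpredT (fun k : 'I_n.+1 => first_max n k)).
    by move=> k; exact: measurable_first_max.
  apply/trivIsetP => i j _ _; apply: contraNeq => /set0P[w [wi wj]].
  by apply/eqP/val_inj; apply: first_max_uniq wi wj; rewrite -ltnS.
apply: EFin_inj; rewrite -sumEFin.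
rewrite (eq_bigr (fun k : 'I_n.+1 => P (first_max n k))); last first.
  move=> k _; rewrite (prE P (measurable_first_max n k)) first_max_prob//.
  by rewrite -ltnS.
rewrite -H -[RHS](probability_setT P); congr (P _).
apply/seteqP; split => // w _; have [k kn wk] := first_max_cover n w.
rewrite -bigcup_mkord; exists k => //=.
Qed.

Lemma neg_sumsE n : steps (iota 0 n) @^-1` neg_sums =
  [set w | forall j, (0 < j <= n)%N -> S j w < 0].
Proof.
apply/seteqP; split => w; rewrite /neg_sums /= size_map size_iota.
  move=> H j jn; have := H j jn; case/andP: jn => _ jn.
  by rewrite psum_steps// add0n [S 0%N w]big_ord0 subr0.
move=> H j jn; have := H j jn; case/andP: jn => _ jn.
by rewrite psum_steps// add0n [S 0%N w]big_ord0 subr0.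
Qed.

Lemma stay_sub m n : (m <= n)%N -> stay n `<=` stay m.
Proof.
move=> mn w; rewrite !stayE /= => H j /andP[j0 jm].
by apply: H; rewrite j0 (leq_trans jm).
Qed.

Lemma stay_prob_mono m n : (m <= n)%N -> stay_prob n <= stay_prob m.
Proof.
by move=> mn; apply: le_pr; [exact: measurable_stay|exact: measurable_stay|exact: stay_sub].
Qed.

Lemma neg_prob_mono m n : (m <= n)%N -> neg_prob n <= neg_prob m.
Proof.
move=> mn; apply: le_pr; [exact: measurable_steps|exact: measurable_steps|].
rewrite !neg_sumsE /= => w /= H j /andP[j0 jm].
by apply: H; rewrite j0 (leq_trans jm).
Qed.

Lemma stay_prob_ge0 n : 0 <= stay_prob n. Proof. exact: pr_ge0. Qed.

Lemma neg_prob_le n : neg_prob n <= stay_prob n.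
Proof.
apply: le_pr; [exact: measurable_steps|exact: measurable_steps|].
by move=> w H k /H /ltW.
Qed.

Local Notation p := (pr P (xi 0%N @^-1` [set z | z < 0])).

(** It is enough to make a negative first step and then never to rise above the level reached. *)
Lemma neg_prob_ge n : p * stay_prob n <= neg_prob n.+1.
Proof.
have -> : p * stay_prob n = pr P (steps [:: 0%N] @^-1` [set s | head 0 s < 0] `&`
    steps (iota 1 n) @^-1` nonpos_sums).
  rewrite pr_steps_indep; last exact: (iota_uniq 0 n.+1).
  by congr (_ * _); apply: pr_steps_eq; rewrite ?iota_uniq// !size_iota.
apply: le_pr; [|exact: measurable_steps|].
  by apply: measurableI; exact: measurable_steps.
rewrite neg_sumsE => w [/= x0]; rewrite /nonpos_sums /= size_map size_iota => H.
have S1 : S 1%N w < 0 by rewrite /walk big_ord1.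
move=> [|[|j]]// /andP[_ jn].
have := H j.+1 jn; rewrite psum_steps// add1n subr_le0 => /le_lt_trans; exact.
Qed.

(** By monotonicity each of the n + 1 terms of the decomposition is at least p a_n^2. *)
Lemma stay_prob_sqr_le n : p * n.+1%:R * stay_prob n ^+ 2 <= 1.
Proof.
rewrite -[leRHS](first_max_decomposition n).
apply: (@le_trans _ _ (\sum_(k < n.+1) p * stay_prob n ^+ 2)).
  by rewrite sumr_const card_ord -[leRHS]mulr_natl [leRHS]mulrCA [leRHS]mulrA.
apply: ler_sum => k _; rewrite expr2 mulrA ler_pM ?mulr_ge0 ?pr_ge0//.
- by rewrite (le_trans (neg_prob_ge n))// neg_prob_mono// ltnW.
- by rewrite stay_prob_mono// leq_subr.
Qed.

Hypothesis p_gt0 : 0 < p.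

Lemma stay_prob_le n : stay_prob n <= (Num.sqrt p)^-1 / Num.sqrt n.+1%:R.
Proof.
rewrite -invfM -sqrtrM ?pr_ge0//; set u := p * _.
have u0 : 0 < u by rewrite mulr_gt0.
rewrite -[leRHS]mul1r ler_pdivlMr ?sqrtr_gt0//.
rewrite -(ler_pXn2r (ltn0Sn 1)) ?nnegrE ?mulr_ge0 ?stay_prob_ge0 ?sqrtr_ge0//.
by rewrite exprMn sqr_sqrtr ?(ltW u0)// expr1n mulrC stay_prob_sqr_le.
Qed.

Lemma sum_stay_prob_le n :
  \sum_(k < n) stay_prob k <= 2 / Num.sqrt p * Num.sqrt n%:R.
Proof.
elim: n => [|n IH]; first by rewrite big_ord0 mulr_ge0 ?divr_ge0 ?sqrtr_ge0.
rewrite big_ord_recr/= (le_trans (lerD IH (stay_prob_le n)))//.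
have sp : 0 < (Num.sqrt p)^-1 by rewrite invr_gt0 sqrtr_gt0.
set y := Num.sqrt n.+1%:R; set x := Num.sqrt n%:R.
have y0 : 0 < y by rewrite sqrtr_gt0.
have yE : y ^+ 2 = n%:R + 1 by rewrite sqr_sqrtr// natr1.
have xE : x ^+ 2 = n%:R by rewrite sqr_sqrtr.
(* The discrete form of the integral of u^(-1/2); multiplied by y it is (x - y)^2 >= 0. *)
have h : x + y^-1 / 2 <= y.
  rewrite -(ler_pM2r y0) mulrDl [y^-1 / 2 * y]mulrAC mulVf ?gt_eqF//.
  have := sqr_ge0 (x - y); nra.
by have := ler_wpM2l (ltW sp) h; lra.
Qed.

(** In the decomposition over [0, 2n], bounded with b_k <= a_k, every term has a factor of index at
    least n, hence at most a_n. So 1 <= 2 a_n (a_0 + ... + a_n), and [sum_stay_prob_le] bounds the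
    sum. *)
Lemma stay_prob_sqr_ge n : p / 16 <= n.+1%:R * stay_prob n ^+ 2.
Proof.
have h : 1 <= 2 * stay_prob n * \sum_(k < n.+1) stay_prob k.
  rewrite -[leLHS](first_max_decomposition n.*2).
  apply: (@le_trans _ _ (\sum_(0 <= k < n.*2.+1) stay_prob k * stay_prob (n.*2 - k))).
    by rewrite big_mkord; apply: ler_sum => k _; rewrite ler_wpM2r ?pr_ge0// neg_prob_le.
  rewrite (big_cat_nat (n := n.+1))//=; last by rewrite ltnS -addnn leq_addl.
  rewrite -mulrA mulr_natl mulr2n lerD//.
    rewrite big_mkord mulr_sumr; apply: ler_sum => k _.
    rewrite mulrC ler_wpM2r ?pr_ge0// stay_prob_mono//.
    by rewrite -addnn -addnBA ?leq_addr// -ltnS.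
  rewrite -{1}[n.+1]add0n big_addn subSS -addnn addnK big_mkord.
  rewrite (reindex_inj rev_ord_inj)/= mulr_sumr.
  rewrite big_ord_recr/= -[leLHS]addr0 lerD ?mulr_ge0 ?stay_prob_ge0//.
  apply: ler_sum => k _; apply: ler_pM; rewrite ?stay_prob_ge0//.
    by rewrite stay_prob_mono// addnS (leq_trans (leq_addl _ _) (leqnSn _)).
  by rewrite stay_prob_mono//; have := ltn_ord k; lia.
have h2 := sum_stay_prob_le n.+1.
set a := stay_prob n; have a0 : 0 <= a := stay_prob_ge0 n.
have {h h2} h : 1 <= 4 * a / Num.sqrt p * Num.sqrt n.+1%:R.
  rewrite (le_trans h)//.
  have -> : 4 * a / Num.sqrt p * Num.sqrt n.+1%:R =
    2 * a * (2 / Num.sqrt p * Num.sqrt n.+1%:R) by ring.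
  by rewrite ler_wpM2l// mulr_ge0.
have sp : 0 < Num.sqrt p by rewrite sqrtr_gt0.
have {}h : Num.sqrt p <= 4 * a * Num.sqrt n.+1%:R.
  by move: h; rewrite mulrAC ler_pdivlMr// mul1r.
have : Num.sqrt p ^+ 2 <= (4 * a * Num.sqrt n.+1%:R) ^+ 2.
  by rewrite lerXn2r// nnegrE ?mulr_ge0// ltW.
by rewrite !exprMn !sqr_sqrtr ?pr_ge0// ler_pdivrMr//; lra.
Qed.

End fluctuation.

(** * The ladder length of the walk on the random medium *)

Section medium_increments.
Context (R : realType) (T : Type) (zeta : int -> T -> R).

Lemma medium_sum a n w : medium zeta (a + n%:Z) w - medium zeta a w =
  \sum_(i < n) zeta (a + i.+1%:Z) w.
Proof.
elim: n => [|n IH]; first by rewrite addr0 subrr big_ord0.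
rewrite big_ord_recr/= -IH -(mediumB zeta (a + n.+1%:Z) w).
rewrite (_ : a + n.+1%:Z - 1 = a + n%:Z); first by ring.
by rewrite intS; ring.
Qed.

Hypothesis zeta_pos : forall k w, 0 < zeta k w.

Lemma normr_medium a b w : `|medium zeta b w - medium zeta a w| =
  \sum_(i < `|b - a|%N) zeta (Num.min a b + i.+1%:Z) w.
Proof.
wlog ab : a b / a <= b.
  move=> H; have /orP[/H//|/H] := le_total a b.
  by rewrite distrC minC -abszN opprB.
rewrite (min_idPl ab) -medium_sum.
have -> : (`|b - a|%N : int) = b - a by rewrite gez0_abs// subr_ge0.
rewrite [a + _]addrC subrK ger0_norm//.
have {1}-> : b = a + `|b - a|%N by lia.
by rewrite medium_sum; apply: sumr_ge0 => i _; exact: ltW.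
Qed.

End medium_increments.

Section ladder.
Context d (T : measurableType d) (R : realType).
Context (xi : nat -> T -> int) (zeta : int -> T -> R).

Local Notation S := (walk xi).
Local Notation Y := (walk_on_medium S (medium zeta)).
Local Notation L := (ladder_length (@ladder_time R T S) Y).

Definition increment k w := `|Y k.+1 w - Y k w|.

Lemma increment_ge0 k w : 0 <= increment k w. Proof. exact: normr_ge0. Qed.

Let term_ge0 k w : 0 <= \1_(stay xi k) w * increment k w.
Proof. by rewrite mulr_ge0 ?increment_ge0// indicE ler0n. Qed.

(** The step from time k to k + 1 counts when S has not been positive up to time k: the step that
    makes S positive is still counted. *)
Lemma le_ladder_time k w :
  (k.+1%:R%:E <= @ladder_time R T S w)%E = (w \in stay xi k).
Proof.
apply/ereal_infP/idP => [H|].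
  rewrite inE stayE /= => j /andP[j0 jk]; rewrite leNgt; apply/negP => Sj.
  have : (k.+1%:R%:E <= j%:R%:E :> \bar R)%E by apply: H; exists j.
  by rewrite lee_fin ler_nat ltnNge jk.
rewrite inE stayE /= => H _ [j [j0 Sj] <-]; rewrite lee_fin ler_nat ltnNge.
by apply/negP => jk; have := H j; rewrite j0 jk leNgt Sj => /(_ isT).
Qed.

Lemma ladder_lengthE w :
  L w = (\sum_(0 <= k <oo) (\1_(stay xi k) w * increment k w)%:E)%E.
Proof.
rewrite /ladder_length eseries_mkcond -(nneseries_addn 1); last first.
  by move=> i; case: ifP.
apply: eq_eseriesr => k _; rewrite addn1 le_ladder_time indicE.
by case: ifP; rewrite ?mul1r ?mul0r.
Qed.

Lemma ladder_length_ge n w : stay xi n w ->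
  ((\sum_(k < n.+1) increment k w)%:E <= L w)%E.
Proof.
move=> wn; rewrite ladder_lengthE.
apply: le_trans (nneseries_lim_ge n.+1 _); last first.
  by move=> k _ _; rewrite lee_fin term_ge0.
rewrite big_mkord -sumEFin le_eqVlt; apply/orP; left; apply/eqP.
apply: eq_bigr => k _; rewrite indicE mem_set ?mul1r//.
by apply: stay_sub wn; rewrite -ltnS.
Qed.

(** Pathwise form of the upper bound. If S became positive by time n, the counted increments before
    n sum to more than x; either one truncated term is already 1, or no truncation occurs and the
    rescaled sum exceeds 1. *)
Lemma ladder_length_le x n w : 0 < x -> (x%:E < L w)%E ->
  1 <= \1_(stay xi n) w +
    \sum_(k < n) \1_(stay xi k) w * Num.min 1 (x^-1 * increment k w) :> R.
Proof.
move=> x0 xL; pose u k : R := \1_(stay xi k) w * Num.min 1 (x^-1 * increment k w).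
have u0 k : 0 <= u k.
  by rewrite mulr_ge0 ?indicE ?ler0n// le_min ler01 mulr_ge0 ?increment_ge0// invr_ge0 ltW.
have [wn|wn] := boolP (w \in stay xi n).
  by rewrite {1}indicE wn lerDl; apply: sumr_ge0 => k _; exact: u0.
rewrite {1}indicE (negbTE wn) add0r -/u.
have sum_gt : x < \sum_(k < n) \1_(stay xi k) w * increment k w.
  move: xL; rewrite ladder_lengthE (nneseries_split 0 n)//; last first.
    by move=> k _; rewrite lee_fin term_ge0.
  rewrite add0n [X in (_ + X)%E]eseries0; last first.
    move=> k nk _; rewrite indicE memNset ?mul0r// => wk.
    by move/negP : wn; apply; rewrite inE; exact: stay_sub wk.
  by rewrite adde0 sumEFin lte_fin big_mkord.
have [big|small] := pselect (exists k : 'I_n, 1 <= u k).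
  case: big => k uk; rewrite (bigD1 k)//= (le_trans uk)// lerDl.
  by apply: sumr_ge0 => j _; exact: u0.
rewrite (eq_bigr (fun k : 'I_n => x^-1 * (\1_(stay xi k) w * increment k w))).
  by rewrite -mulr_sumr ler_pdivlMl// mulr1 ltW.
move=> k _; rewrite mulrCA; have [wk|wk] := boolP (w \in stay xi k); last first.
  by rewrite indicE (negbTE wk) !mul0r.
congr (_ * _); apply/min_idPr; rewrite leNgt; apply/negP => h; apply: small.
by exists k; rewrite /u indicE wk mul1r le_min lexx ltW.
Qed.

End ladder.

(** * Evaluation at a random index, and integration under independence *)

Section measurability.
Context d (T : measurableType d) (R : realType).

(** Needed because Y evaluates the random medium at a random site. *)
Lemma measurable_countable_comp (C : countType) (X : T -> C) (F : C -> T -> R) :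
  (forall c, measurable (X @^-1` [set c])) ->
  (forall c, measurable_fun setT (F c)) ->
  measurable_fun setT (fun w => F (X w) w).
Proof.
move=> mX mF _ B mB; rewrite setTI.
rewrite (_ : _ @^-1` _ = \bigcup_n
  (if pickle_inv n is Some c then X @^-1` [set c] `&` F c @^-1` B else set0)).
  apply: bigcupT_measurable => n; case: pickle_inv => // c.
  by apply: measurableI => //; rewrite -[X in measurable X]setTI; exact: mF.
apply/seteqP; split => w /=.
  by move=> Bw; exists (pickle (X w)) => //; rewrite pickleK_inv.
by case=> n _; case: pickle_inv => // c [/= ->].
Qed.

Context (P : probability T R).

Lemma ge0_integral_mrestr A (mA : measurable A) (f : T -> \bar R) :
  measurable_fun setT f -> (forall w, (0 <= f w)%E) ->
  (\int[mrestr P mA]_w f w = \int[P]_(w in A) f w)%E.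
Proof.
move=> mf f0; rewrite -(setvU A) ge0_integral_setU//; last 3 first.
- exact: measurableC.
- by rewrite setvU.
- by apply/disj_setPS; rewrite setICl.
rewrite (eq_measure_integral mzero) ?integral_measure_zero ?add0e; last first.
  move=> B _ BA; have BA0 : B `&` A = set0.
    by apply/seteqP; split => // w [/BA].
  by rewrite /= /mrestr BA0 measure0.
by apply: eq_measure_integral => B mB BA; rewrite /= /mrestr setIidl.
Qed.

(** The image under V of P restricted to A is P(A) times the law of V'. *)
Lemma ge0_integral_indep A (V V' : T -> R) (f : R -> \bar R) :
  measurable A -> measurable_fun setT V -> measurable_fun setT V' ->
  (forall B, measurable B -> P (V @^-1` B) = P (V' @^-1` B)) ->
  (forall B, measurable B -> P (A `&` V @^-1` B) = P A * P (V @^-1` B))%E ->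
  measurable_fun setT f -> (forall x, (0 <= f x)%E) ->
  (\int[P]_(w in A) f (V w) = P A * \int[P]_w f (V' w))%E.
Proof.
move=> mA mV mV' VV' AV mf f0.
have mfV : measurable_fun setT (f \o V) by exact: measurableT_comp.
rewrite -(ge0_integral_mrestr mA mfV (fun w => f0 (V w))).
have := @ge0_integral_pushforward _ _ _ _ R V mV (mrestr P mA) setT f measurableT mf.
rewrite preimage_setT => <-; last by [].
have := @ge0_integral_pushforward _ _ _ _ R V' mV' P setT f measurableT mf.
rewrite preimage_setT => E.
rewrite [X in (_ * X)%E](_ : _ = \int[pushforward P V']_y f y)%E; last first.
  by rewrite E// => y _; exact: f0.
rewrite prE//; have := @ge0_integral_mscale _ _ R (pushforward P V') setT measurableT
  (NngNum (pr_ge0 P A)) f mf (fun x _ => f0 x).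
move=> /= <-; apply: eq_measure_integral => B mB _.
by rewrite /= /pushforward /mrestr /mscale/= -prE// setIC AV// VV'.
Qed.

End measurability.

Section walk_on_medium_events.
Context d (T : measurableType d) (R : realType) (P : probability T R).
Context (xi : nat -> T -> int) (zeta : int -> T -> R).
Hypothesis mxi : forall k, measurable_fun setT (xi k).
Hypothesis mzeta : forall k, measurable_fun setT (zeta k).
Hypothesis zeta_pos : forall k w, 0 < zeta k w.
Hypothesis zeta_ident : identically_distributed P zeta.
Hypothesis S_zeta_indep : independent_processes P (walk xi) zeta.

Local Notation S := (walk xi).
Local Notation Y := (walk_on_medium S (medium zeta)).
Local Notation L := (ladder_length (@ladder_time R T S) Y).
Local Notation dY := (increment xi zeta).
Local Notation sigmaS := (process_sigma_algebra S).

Lemma walkS k w : S k.+1 w = S k w + xi k w.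
Proof. by rewrite /walk big_ord_recr. Qed.

Lemma sigma_walk k A : sigmaS (S k @^-1` A).
Proof.
apply: sub_sigma_algebra; exists k => //; exists A => //.
by rewrite setTI.
Qed.

(** The sample space equipped with the sigma-algebra of the walk: general measurability lemmas,
    instantiated at this type, prove that events depend on the walk only. *)
Let GS := g_sigma_algebraType (\bigcup_i preimage_set_system setT (S i) measurable).

Lemma sigma_walkI A B : sigmaS A -> sigmaS B -> sigmaS (A `&` B).
Proof. exact: (@measurableI _ GS A B). Qed.

Lemma sigma_walk_countable (C : countType) (X : T -> C) A :
  (forall c, sigmaS (X @^-1` [set c])) -> sigmaS (X @^-1` A).
Proof. exact: (@measurable_countable_preimage _ GS C X A). Qed.

(** Independence of the medium is assumed for the walk; events on the steps inherit it because a
    step is a difference of two positions. *)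
Lemma sigma_step k A : sigmaS (xi k @^-1` A).
Proof.
pose X w := (S k w, S k.+1 w).
rewrite (_ : _ @^-1` _ = X @^-1` [set ab | A (ab.2 - ab.1)]); last first.
  by apply/seteqP; split => w /=; rewrite walkS addrAC subrr add0r.
apply: sigma_walk_countable => -[a b].
rewrite (_ : _ @^-1` _ = S k @^-1` [set a] `&` S k.+1 @^-1` [set b]).
  by apply: sigma_walkI; exact: sigma_walk.
by apply/seteqP; split => w /=; rewrite /X; [case=> <- <-|case=> -> ->].
Qed.

Lemma sigma_steps J A : sigmaS (steps xi J @^-1` A).
Proof.
apply: (@measurable_steps _ GS xi) => k _ B _.
by rewrite setTI; exact: sigma_step.
Qed.

Lemma sigma_stay n : sigmaS (stay xi n).
Proof. exact: sigma_steps. Qed.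

Lemma sigma_medium_bond k B : measurable B ->
  process_sigma_algebra zeta (zeta k @^-1` B).
Proof.
by move=> mB; apply: sub_sigma_algebra; exists k => //; exists B; rewrite ?setTI.
Qed.

Lemma measurable_walk1 k c : measurable (S k @^-1` [set c]).
Proof.
rewrite (_ : _ @^-1` _ = steps xi (iota 0 k) @^-1` [set s | psum s k = c]).
  exact: measurable_steps.
by apply/seteqP; split => w /=; rewrite psum_steps// add0n [S 0%N w]big_ord0 subr0.
Qed.

Lemma measurable_medium a : measurable_fun setT (medium zeta a).
Proof.
case: a => n /=; first exact: measurable_sum.
by apply: measurable_funN; exact: measurable_sum.
Qed.

Lemma measurable_increment k : measurable_fun setT (dY k).
Proof.
apply: measurableT_comp => //; apply: measurable_funB;
  apply: (measurable_countable_comp (F := medium zeta)) => [c|c];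
  by [exact: measurable_walk1|exact: measurable_medium].
Qed.

Lemma measurable_ladder_length_gt x : measurable [set w | (x%:E < L w)%E].
Proof.
have LE : L = fun w =>
    (\sum_(0 <= k <oo | k \in xpredT) (\1_(stay xi k) w * dY k w)%:E)%E.
  by apply/funext => w; rewrite ladder_lengthE.
rewrite -[X in measurable X]setTI; apply: emeasurable_fun_o_infty => //.
rewrite LE; apply: ge0_emeasurable_sum => [k w _ _|k _].
  by rewrite lee_fin mulr_ge0 ?increment_ge0// indicE ler0n.
apply/measurable_EFinP; apply: measurable_funM; last exact: measurable_increment.
by apply: measurable_indic; exact: measurable_stay.
Qed.

End walk_on_medium_events.

Lemma min1D_le (R : realDomainType) (u v : R) : 0 <= u -> 0 <= v ->
  Num.min 1 (u + v) <= Num.min 1 u + Num.min 1 v.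
Proof. by move=> u0 v0; rewrite !minEle; repeat case: ifP; lra. Qed.

Lemma min1_sum_le (R : realDomainType) n (f : 'I_n -> R) :
  (forall i, 0 <= f i) -> Num.min 1 (\sum_i f i) <= \sum_i Num.min 1 (f i).
Proof.
elim: n f => [|n IH] f f0; first by rewrite !big_ord0 ge_min lexx orbT.
rewrite !big_ord_recl (le_trans (min1D_le _ _))//; first exact: sumr_ge0.
by rewrite lerD2l IH.
Qed.

Lemma trunc_moment1E d (T : measurableType d) (R : realType)
  (P : probability T R) (X : T -> R) t : measurable_fun setT X ->
  (\int[P]_w (Num.min 1 `|t * X w|)%:E)%E = (trunc_moment1 P X t)%:E.
Proof.
move=> mX; rewrite /trunc_moment1 /Rintegral fineK//.
apply: integrable_fin_num => //.
apply: (@bounded_integrable _ _ _ _ _ 1) => [|w]; last exact: normr_min1_le.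
apply: measurable_minr => //; apply: measurableT_comp => //.
exact: measurable_funM.
Qed.

(** * Upper bound by truncated expectations *)

Section upper_bound.
Context d (T : measurableType d) (R : realType) (P : probability T R).
Context (xi : nat -> T -> int) (zeta : int -> T -> R).
Hypothesis mxi : forall k, measurable_fun setT (xi k).
Hypothesis xi_indep : mutually_independent P xi.
Hypothesis xi_ident : identically_distributed P xi.
Hypothesis mzeta : forall k, measurable_fun setT (zeta k).
Hypothesis zeta_pos : forall k w, 0 < zeta k w.
Hypothesis zeta_ident : identically_distributed P zeta.
Hypothesis S_zeta_indep : independent_processes P (walk xi) zeta.

Local Notation S := (walk xi).
Local Notation Y := (walk_on_medium S (medium zeta)).
Local Notation L := (ladder_length (@ladder_time R T S) Y).
Local Notation dY := (increment xi zeta).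
Local Notation sigmaS := (process_sigma_algebra S).

Definition stepR w : R := (xi 0%N w)%:~R.

Lemma measurable_int (X : T -> int) (f : int -> R) :
  measurable_fun setT X -> measurable_fun setT (fun w => f (X w)).
Proof. by move=> mX; apply: measurableT_comp mX. Qed.

Lemma integral_bond A j t : sigmaS A -> measurable A ->
  (\int[P]_(w in A) (Num.min 1 `|t * zeta j w|)%:E =
   (pr P A * trunc_moment1 P (zeta 1) t)%:E)%E.
Proof.
move=> sA mA; pose f (y : R) : \bar R := (Num.min 1 `|t * y|)%:E.
have mf : measurable_fun setT f.
  apply/measurable_EFinP; apply: measurable_minr => //.
  by apply: measurableT_comp => //; exact: measurable_funM.
have f0 y : (0 <= f y)%E by rewrite lee_fin le_min ler01/=.
rewrite (@ge0_integral_indep _ _ _ P A (zeta j) (zeta 1) f)//.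
- by rewrite EFinM -trunc_moment1E// prE.
- by move=> B mB; exact: zeta_ident.
- by move=> B mB; apply: S_zeta_indep => //; exact: sigma_medium_bond.
Qed.

Let q x := trunc_moment1 P (zeta 1) x^-1.

Lemma q_ge0 x : 0 <= q x.
Proof. by apply: Rintegral_ge0 => w _; rewrite le_min ler01/=. Qed.

(** Once (S_k, S_(k+1)) = (a, b) is fixed, the increment is a sum of |b - a| given bonds, still
    independent of the walk. Averaging over the medium gives at most 1 and, by subadditivity of
    min(1, .), at most q |b - a|. *)
Lemma integral_increment_le k x : 0 < x ->
  (\int[P]_(w in stay xi k) (Num.min 1 (x^-1 * dY k w))%:E <=
   \int[P]_(w in stay xi k) (Num.min 1 `|q x * (xi k w)%:~R|)%:E)%E.
Proof.
move=> x0; pose X w := (S k w, S k.+1 w).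
have X1 a b : X @^-1` [set (a, b)] = S k @^-1` [set a] `&` S k.+1 @^-1` [set b].
  by apply/seteqP; split => w /=; rewrite /X; [case=> <- <-|case=> -> ->].
have mX c : measurable (X @^-1` [set c]).
  by case: c => a b; rewrite X1; apply: measurableI; exact: measurable_walk1.
have sX c : sigmaS (X @^-1` [set c]).
  by case: c => a b; rewrite X1; apply: sigma_walkI; exact: sigma_walk.
have xV0 : 0 <= x^-1 by rewrite invr_ge0 ltW.
rewrite -[leRHS]mul1e; apply: (le_integral_fibers mX mX).
- exact: measurable_stay.
- exact: measurable_stay.
- apply/measurable_EFinP; apply: measurable_minr => //.
  by apply: measurable_funM => //; exact: measurable_increment.
- apply/measurable_EFinP.
  exact: (measurable_int (fun z => Num.min 1 `|q x * z%:~R|)).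
- by move=> w; rewrite lee_fin le_min ler01 mulr_ge0// increment_ge0.
- by move=> w; rewrite lee_fin le_min ler01/=.
move=> [a b]; set A := _ `&` _; rewrite mul1e.
have mA : measurable A by apply: measurableI => //; exact: measurable_stay.
have sA : sigmaS A by apply: sigma_walkI => //; exact: sigma_stay.
pose n := `|b - a|%N.
have rhsE : (\int[P]_(w in A) (Num.min 1 `|q x * (xi k w)%:~R|)%:E =
    (Num.min 1 (q x * n%:R) * pr P A)%:E)%E.
  rewrite EFinM -prE// -(integral_cst P mA); apply: eq_integral => w.
  rewrite inE /A => -[_ [Sa Sb]]; rewrite (_ : xi k w = b - a); last first.
    by rewrite -Sa -Sb walkS addrAC subrr add0r.
  by rewrite normrM (ger0_norm (q_ge0 x)) /n natr_absz intr_norm.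
rewrite {}rhsE.
have min0 (u : R) : 0 <= u -> (0 <= (Num.min 1 u)%:E)%E.
  by move=> u0; rewrite lee_fin le_min ler01.
have mdY : measurable_fun A (fun w => (Num.min 1 (x^-1 * dY k w))%:E).
  apply: (@measurable_funS _ _ _ _ setT) => //; apply/measurable_EFinP.
  apply: measurable_minr => //.
  by apply: measurable_funM => //; exact: measurable_increment.
have mz j : measurable_fun A (fun w => (Num.min 1 `|x^-1 * zeta j w|)%:E).
  apply: (@measurable_funS _ _ _ _ setT) => //; apply/measurable_EFinP.
  apply: measurable_minr => //; apply: measurableT_comp => //.
  exact: measurable_funM.
have -> : Num.min 1 (q x * n%:R) * pr P A =
    Num.min (pr P A) (n%:R * (pr P A * q x)).
  by rewrite minr_pMl ?pr_ge0// mul1r; congr Num.min; ring.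
rewrite EFin_min le_min; apply/andP; split.
  rewrite -prE// -[leRHS]mul1e -(integral_cst P mA).
  apply: ge0_le_integral => //.
  - by move=> w _; rewrite min0// mulr_ge0// increment_ge0.
  - by move=> w _; rewrite lee_fin ge_min lexx.
apply: (@le_trans _ _ (\int[P]_(w in A) \sum_(i < n)
    (Num.min 1 `|x^-1 * zeta (Num.min a b + i.+1%:Z) w|)%:E)%E).
  apply: ge0_le_integral => //.
  - by move=> w _; rewrite min0// mulr_ge0// increment_ge0.
  - exact: emeasurable_sum.
  - move=> w [_ [Sa Sb]]; rewrite sumEFin lee_fin /increment /walk_on_medium Sa Sb.
    rewrite normr_medium// mulr_sumr (le_trans (min1_sum_le _))//.
      by move=> i; rewrite mulr_ge0// ltW.
    by apply: ler_sum => i _; rewrite ger0_norm// mulr_ge0// ltW.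
rewrite ge0_integral_sum//.
under eq_bigr do rewrite integral_bond//.
by rewrite sumEFin sumr_const card_ord mulr_natl.
Qed.

(** The event [stay xi k] involves only the steps of index below k, so it is independent of
    [xi k]. *)
Lemma integral_step k t : (\int[P]_(w in stay xi k) (Num.min 1 `|t * (xi k w)%:~R|)%:E
  <= (stay_prob P xi k * trunc_moment1 P stepR t)%:E)%E.
Proof.
have m01 j : measurable_fun setT (fun w => (Num.min 1 `|t * (xi j w)%:~R|)%:E).
  by apply/measurable_EFinP; exact: (measurable_int (fun z => Num.min 1 `|t * z%:~R|)).
rewrite EFinM -trunc_moment1E; last exact: (measurable_int (fun z => z%:~R)).
have mxi1 j c : measurable (xi j @^-1` [set c]) by exact: measurable_step.
apply: (le_integral_fibers (mxi1 k) (mxi1 0%N)) => //.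
- exact: measurable_stay.
- exact: (m01 0%N).
move=> z; set c := (Num.min 1 `|t * z%:~R|)%:E.
rewrite (eq_integral (cst c)); last by move=> w; rewrite inE => -[_ /= ->].
rewrite [X in (_ <= _ * X)%E](eq_integral (cst c)); last first.
  by move=> w; rewrite inE /stepR => -[_ /= ->].
have ms := measurable_stay mxi k.
rewrite !integral_cst//; [|exact: measurableI|exact: measurableI].
rewrite setTI muleCA le_eqVlt; apply/orP; left; apply/eqP; congr (_ * _)%E.
transitivity (pr P (stay xi k `&` xi k @^-1` [set z]))%:E.
  by apply: prE; exact: measurableI.
transitivity (stay_prob P xi k * pr P (xi 0%N @^-1` [set z]))%:E; last first.
  by rewrite EFinM; congr (_ * _)%E; apply/esym/prE.
congr EFin.
have := @pr_steps_indep _ _ _ P xi mxi xi_indep xi_ident (iota 0 k) [:: k]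
  nonpos_sums [set [:: z]].
rewrite -(iotaD 0 k 1) iota_uniq => /(_ isT).
have stepE j : steps xi [:: j] @^-1` [set [:: z]] = xi j @^-1` [set z].
  by apply/seteqP; split => w /=; [case|move=> ->].
rewrite stepE => ->; congr (_ * _).
by rewrite /pr (xi_ident k 0%N).
Qed.

Lemma ladder_length_tail_le x n : 0 < x ->
  pr P [set w | (x%:E < L w)%E] <= stay_prob P xi n +
    (\sum_(k < n) stay_prob P xi k) * trunc_moment1 P stepR (q x).
Proof.
move=> x0; have mL := measurable_ladder_length_gt mxi mzeta x.
have xV0 : 0 <= x^-1 by rewrite invr_ge0 ltW.
have ms := measurable_stay mxi.
pose g k w : \bar R := (\1_(stay xi k) w * Num.min 1 (x^-1 * dY k w))%:E.
have g0 k w : (0 <= g k w)%E.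
  rewrite lee_fin mulr_ge0 ?indicE ?ler0n// le_min ler01 mulr_ge0//.
  exact: increment_ge0.
have mg k : measurable_fun setT (g k).
  apply/measurable_EFinP; apply: measurable_funM; first exact: measurable_indic.
  apply: measurable_minr => //.
  by apply: measurable_funM => //; exact: measurable_increment.
have gE k : (\int[P]_w g k w = \int[P]_(w in stay xi k) (Num.min 1 (x^-1 * dY k w))%:E)%E.
  rewrite [RHS]integral_mkcond; apply: eq_integral => w _.
  by rewrite /g patchE indicE; case: ifP => _; rewrite ?mul1r ?mul0r.
rewrite -lee_fin -prE// -(setIT [set w | _]) -integral_indic//.
apply: (@le_trans _ _ (\int[P]_w ((\1_(stay xi n) w)%:E + \sum_(k < n) g k w))%E).
  apply: ge0_le_integral => //.
  - by apply/measurable_EFinP; exact: measurable_indic.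
  - apply: emeasurable_funD; last exact: emeasurable_sum.
    by apply/measurable_EFinP; exact: measurable_indic.
  move=> w _; rewrite sumEFin -EFinD lee_fin.
  have [|] := boolP (w \in [set w | (x%:E < L w)%E]).
    move=> wx; rewrite indicE wx; apply: ladder_length_le => //.
    by move: wx; rewrite inE.
  move=> /negbTE wx; rewrite {1}indicE wx.
  rewrite addr_ge0 ?indicE ?ler0n//; apply: sumr_ge0 => k _.
  by have := g0 k w; rewrite lee_fin indicE.
rewrite ge0_integralD//; last 3 first.
- by apply/measurable_EFinP; exact: measurable_indic.
- by move=> w _; apply: sume_ge0 => k _; exact: g0.
- exact: emeasurable_sum.
rewrite EFinD leeD//.
  rewrite integral_indic// setIT le_eqVlt; apply/orP; left; apply/eqP.
  exact: prE.
rewrite ge0_integral_sum//.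
rewrite mulr_suml -sumEFin; apply: lee_sum => k _; rewrite gE.
exact: le_trans (integral_increment_le k x0) (integral_step _ _).
Qed.

End upper_bound.

(** * Lower bound: long increments in [N, 2N) *)

Section lower_bound.
Context d (T : measurableType d) (R : realType) (P : probability T R).
Context (xi : nat -> T -> int) (zeta : int -> T -> R).
Hypothesis mxi : forall k, measurable_fun setT (xi k).
Hypothesis xi_indep : mutually_independent P xi.
Hypothesis xi_ident : identically_distributed P xi.
Hypothesis xi_sym : symmetric_law P (xi 0%N).
Hypothesis mzeta : forall k, measurable_fun setT (zeta k).
Hypothesis zeta_pos : forall k w, 0 < zeta k w.
Hypothesis zeta_indep : mutually_independent P zeta.
Hypothesis zeta_ident : identically_distributed P zeta.
Hypothesis S_zeta_indep : independent_processes P (walk xi) zeta.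

Local Notation S := (walk xi).
Local Notation Y := (walk_on_medium S (medium zeta)).
Local Notation L := (ladder_length (@ladder_time R T S) Y).
Local Notation dY := (increment xi zeta).
Local Notation sigmaS := (process_sigma_algebra S).
Local Notation p := (pr P (xi 0%N @^-1` [set z | z < 0])).

Definition jump_prob (M : nat) := pr P (xi 0%N @^-1` [set z | (M <= `|z|)%N]).
Definition bond_tail (x : R) := pr P [set w | x < zeta 1 w].

Lemma measurable_bond_gt j x : measurable [set w | x < zeta j w].
Proof. by apply: (measurable_lt (f := cst x)). Qed.

Lemma walk_psum n j w : (j <= n)%N -> S j w = psum (steps xi (iota 0 n) w) j.
Proof.
by move=> jn; rewrite psum_steps// add0n [X in _ - X]big_ord0 subr0.
Qed.

Lemma pr_small_steps J M : uniq J ->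
  pr P (steps xi J @^-1` [set s | all (fun z => `|z| < M)%N s]) =
  (1 - jump_prob M) ^+ size J.
Proof.
elim: J => [_|j J IH /= /andP[jJ uJ]].
  rewrite (_ : _ @^-1` _ = setT) ?expr0 /pr ?probability_setT//.
  by apply/seteqP; split.
rewrite (_ : _ @^-1` _ = steps xi [:: j] @^-1` [set s | all (fun z => `|z| < M)%N s] `&`
    steps xi J @^-1` [set s | all (fun z => `|z| < M)%N s]); last first.
  by apply/seteqP; split => w /=; [case/andP=> -> ->|case; rewrite andbT => -> ->].
rewrite pr_steps_indep//=; last by rewrite jJ.
rewrite IH// exprS; congr (_ * _).
rewrite (@pr_steps_eq _ _ _ P xi mxi xi_indep xi_ident [:: j] [:: 0%N])//.
rewrite -prC; last exact: measurable_step.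
congr (pr P _); apply/seteqP; split => w /=; rewrite andbT ltnNge.
  by move/negP.
by move/negP.
Qed.

Lemma pr_small_bonds c M x :
  let J := [seq (c + i.+1%:Z)%R | i <- iota 0 M] in
  let B := \bigcap_(j in [set` J]) [set w | zeta j w <= x] in
  [/\ measurable B, pr P B = (1 - bond_tail x) ^+ M &
      process_sigma_algebra zeta B].
Proof.
move=> J B; have uJ : uniq J.
  rewrite map_inj_uniq ?iota_uniq// => i j /addrI [] //.
have leE j : [set w | zeta j w <= x] = zeta j @^-1` `]-oo, x]%classic.
  by apply/seteqP; split => w /=; rewrite in_itv.
have BE : B = \bigcap_(j in [set` J]) (zeta j @^-1` `]-oo, x]%classic).
  by apply: eq_bigcapr => j _; exact: leE.
have mz j : measurable (zeta j @^-1` `]-oo, x]%classic).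
  by rewrite -[X in measurable X]setTI; exact: mzeta.
have mB : measurable B by rewrite BE; exact: fin_bigcap_measurable.
split => //; last first.
  rewrite BE; pose GZ := g_sigma_algebraType
    (\bigcup_k preimage_set_system setT (zeta k) measurable).
  apply: (@fin_bigcap_measurable _ GZ _ [set` J]
    (fun j => zeta j @^-1` `]-oo, x]%classic) (finite_seq J)) => j _.
  exact: sigma_medium_bond.
have prz j : P (zeta j @^-1` `]-oo, x]%classic) = (1 - bond_tail x)%:E.
  rewrite (zeta_ident j 1)// prE//; congr EFin.
  rewrite -prC; last exact: measurable_bond_gt.
  by congr (pr P _); apply/seteqP; split => w /=; rewrite in_itv/= leNgt => /negP.
apply: EFin_inj; rewrite -prE//.
rewrite BE (@zeta_indep J (fun=> `]-oo, x]%classic) uJ)//.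
have -> : M = size J by rewrite size_map size_iota.
elim: J {uJ B BE mB} => [|j J IH]; first by rewrite big_nil expr0.
by rewrite big_cons IH prz exprS EFinM.
Qed.

Definition quiet (K r : nat) (x : R) : set T :=
  \bigcap_(k in [set k | (K <= k < K + r)%N]) [set w | dY k w <= x].

Lemma measurable_quiet K r x : measurable (quiet K r x).
Proof.
apply: bigcap_measurableType => k _.
rewrite (_ : mkset _ = ~` [set w | x < dY k w]).
  apply: measurableC; apply: (measurable_lt (f := cst x)) => //.
  exact: measurable_increment.
by apply/seteqP; split => w /=; rewrite leNgt => /negP.
Qed.

Lemma bond_tail_le1 x : 0 <= 1 - bond_tail x.
Proof. by rewrite subr_ge0 pr_le1//; exact: measurable_bond_gt. Qed.

(* Conditionally on the walk, a jump over at least M bonds is short only if none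
   of these bonds is longer than x. *)
Lemma pr_quiet_jump N K r M x : (N <= K)%N ->
  pr P (stay xi N `&` (quiet K r x `&`
    ~` (steps xi (iota K r) @^-1` [set s | all (fun z => `|z| < M)%N s]))) <=
  (1 - bond_tail x) ^+ M * stay_prob P xi N.
Proof.
move=> NK; set small := _ @^-1` _.
have mD : measurable (stay xi N `&` (quiet K r x `&` ~` small)).
  apply: measurableI; first exact: measurable_stay.
  apply: measurableI; first exact: measurable_quiet.
  by apply: measurableC; exact: measurable_steps.
(* All steps up to the end of the block are fixed; this decides persistence and where the large jump
   lies, and leaves only the medium random. *)
pose X := steps xi (iota 0 (K + r)).
have mX v : measurable (X @^-1` [set v]) by exact: measurable_steps1.
apply: (le_pr_fibers mX mX) => //; first exact: measurable_stay.
move=> v; set D := (X in pr P (X `&` _)).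
(* In a nonempty fiber one sample point [w0] represents the common path of all the others. *)
have [->|/set0P[w0 [[w0s [w0q w0j]] Xw0]]] := eqVneq (D `&` X @^-1` [set v]) set0.
  by rewrite {1}/pr measure0 mulr_ge0 ?exprn_ge0 ?pr_ge0 ?bond_tail_le1.
have Sv w j : X w = v -> (j <= K + r)%N -> S j w = S j w0.
  by move=> Xw jKr; rewrite (walk_psum _ jKr) (walk_psum w0 jKr) -/(X w) -/(X w0) Xw Xw0.
have -> : stay xi N `&` X @^-1` [set v] = X @^-1` [set v].
  apply/seteqP; split => [w []//|w Xw]; split => //.
  move: w0s; rewrite !stayE /= => H j /andP[j0 jN]; rewrite (Sv w)//; last first.
    by rewrite (leq_trans jN)// (leq_trans NK) ?leq_addr.
  by apply: H; rewrite j0.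
have [k /andP[Kk kr] Mk] : exists2 k, (K <= k < K + r)%N & (M <= `|xi k w0|)%N.
  apply: contra_notP w0j => H; rewrite /small /= all_map; apply/allP => k.
  rewrite mem_iota => kKr /=; rewrite ltnNge; apply/negP => Mk.
  by apply: H; exists k.
have Sk w : X w = v -> S k w = S k w0 /\ S k.+1 w = S k.+1 w0.
  by move=> Xw; split; apply: Sv => //; exact: ltnW.
pose c := Num.min (S k w0) (S k.+1 w0).
(* The bonds c + 1, ..., c + M are crossed by the jump; if the jump is short, each of them is at
   most x. *)
have [] := pr_small_bonds c M x; set B := \bigcap_(j in _) _ => mB prB sB.
apply: (@le_trans _ _ (pr P (X @^-1` [set v] `&` B))).
  apply: le_pr; [exact: measurableI| |].
    exact: measurableI.
  move=> w [[_ [wq _]] Xw]; split => // j jJ.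
  have [i iM ->] := seq.mapP (jJ : j \in [seq c + i.+1%:Z | i <- iota 0 M]).
  move: iM; rewrite mem_iota add0n /= => iM.
  have := wq k; rewrite /= Kk kr => /(_ isT); apply: le_trans.
  have [E1 E2] := Sk _ Xw.
  rewrite /increment /walk_on_medium E1 E2 normr_medium// -/c.
  have iN : (i < `|S k.+1 w0 - S k w0|)%N.
    by rewrite walkS addrAC subrr add0r (leq_trans iM).
  rewrite (bigD1 (Ordinal iN))//= lerDl; apply: sumr_ge0 => j' _; exact: ltW.
rewrite [leLHS]/pr S_zeta_indep//; last exact: sigma_steps.
rewrite fineM ?fin_num_measure//.
by rewrite -/(pr P B) prB mulrC.
Qed.

(** Either none of the r steps has size at least M, or one has and crosses M short bonds. As N <= K,
    the block is independent of persistence up to N. *)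
Lemma pr_stay_quiet N K r M x : (N <= K)%N ->
  pr P (stay xi N `&` quiet K r x) <=
  ((1 - jump_prob M) ^+ r + (1 - bond_tail x) ^+ M) * stay_prob P xi N.
Proof.
move=> NK; set small := steps xi (iota K r) @^-1` [set s | all (fun z => `|z| < M)%N s].
have mst := measurable_stay mxi N.
have msm : measurable small by exact: measurable_steps.
have mq := measurable_quiet K r x.
rewrite mulrDl; apply: (@le_trans _ _
    (pr P (stay xi N `&` small) + pr P (stay xi N `&` (quiet K r x `&` ~` small)))).
  apply: (@le_trans _ _ (pr P ((stay xi N `&` small) `|`
      (stay xi N `&` (quiet K r x `&` ~` small))))).
    apply: le_pr; [exact: measurableI| |].
      apply: measurableU; apply: measurableI => //.
      by apply: measurableI => //; exact: measurableC.
    by move=> w [ws wq]; have [wsm|wsm] := pselect (small w); [left|right].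
  apply: prU_le; first exact: measurableI.
  by apply: measurableI => //; apply: measurableI => //; exact: measurableC.
rewrite lerD ?pr_quiet_jump//.
rewrite pr_steps_indep//; last first.
  rewrite cat_uniq !iota_uniq andbT/=; apply/hasPn => j; rewrite !mem_iota add0n /=.
  by case/andP=> Kj _; rewrite -leqNgt (leq_trans NK).
by rewrite pr_small_steps ?iota_uniq// size_iota mulrC.
Qed.

Hypothesis p_gt0 : 0 < p.

(* The gap between the two-sided estimates of [stay_prob] absorbs an event of
   relative probability [p / 16]. *)
Lemma ladder_tail_ge N (F : set T) x : measurable F ->
  pr P (stay xi N `&` F) <= p / 16 * stay_prob P xi N ->
  (forall w, stay xi N.*2 w -> ~ F w -> (x%:E < L w)%E) ->
  Num.sqrt p / 16 / Num.sqrt N.+1%:R <= pr P [set w | (x%:E < L w)%E].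
Proof.
move=> mF NF HL; have ms := measurable_stay mxi.
have mL := measurable_ladder_length_gt mxi mzeta x.
have h1 : stay_prob P xi N.*2 <= pr P [set w | (x%:E < L w)%E] + pr P (stay xi N `&` F).
  apply: (@le_trans _ _ (pr P ([set w | (x%:E < L w)%E] `|` (stay xi N `&` F)))).
    apply: le_pr => //; first by apply: measurableU => //; exact: measurableI.
    move=> w ws; have [Fw|nFw] := pselect (F w); last by left; exact: HL.
    by right; split => //; apply: stay_sub ws; rewrite -addnn leq_addr.
  by apply: prU_le => //; exact: measurableI.
have h2 := stay_prob_le mxi xi_indep xi_ident xi_sym p_gt0 N.
have h3 := stay_prob_sqr_ge mxi xi_indep xi_ident xi_sym p_gt0 N.*2.
have a0 : 0 <= stay_prob P xi N.*2 by exact: pr_ge0.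
set a := stay_prob P xi N.*2 in a0 h1 h3.
set b := stay_prob P xi N in NF h2.
set s := Num.sqrt p in h2 *; set t := Num.sqrt N.+1%:R in h2 *.
have s0 : 0 < s by rewrite sqrtr_gt0.
have t0 : 0 < t by rewrite sqrtr_gt0.
have sE : s ^+ 2 = p by rewrite sqr_sqrtr// ltW.
have tE : t ^+ 2 = N.+1%:R by rewrite sqr_sqrtr.
have bt : b * t <= s^-1 by rewrite -ler_pdivlMr.
(* By [h3] and 2N + 1 <= 2 (N + 1), (a t)^2 >= p / 32, and 32 < 36. Removing the s / 16 of the bad
   event from s / 6 leaves more than s / 16. *)
have ha : s / 6 <= a * t.
  rewrite leNgt; apply/negP => lt.
  have : (a * t) ^+ 2 < (s / 6) ^+ 2 by rewrite ltr_pXn2r// nnegrE ?mulr_ge0// ltW.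
  rewrite !exprMn tE sE; move: h3.
  have : (N.*2.+1%:R : R) <= 2 * N.+1%:R by rewrite -natrM ler_nat mul2n doubleS.
  have := sqr_ge0 a; move: (a ^+ 2) (N.*2.+1%:R : R) (N.+1%:R : R) => y u v.
  by nra.
rewrite ler_pdivrMr//.
have : p / 16 * b * t <= s / 16.
  rewrite -mulrA -sE.
  have -> : s / 16 = s ^+ 2 / 16 * s^-1 by field; rewrite gt_eqF.
  by rewrite ler_wpM2l// divr_ge0// sqr_ge0.
have := ler_wpM2r (ltW t0) h1; have := ler_wpM2r (ltW t0) NF.
rewrite !mulrDl; lra.
Qed.

End lower_bound.

(** * Asymptotics *)

(** Markov's inequality on [A] for the number of events [B i] that occur. *)
Lemma count_pr_le d (T : measurableType d) (R : realType) (P : probability T R)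
  m (A F : set T) (B : 'I_m -> set T) (t : R) : 0 <= t ->
  measurable A -> measurable F -> (forall i, measurable (B i)) ->
  (forall w, F w -> t <= \sum_i \1_(B i) w) ->
  t * pr P (A `&` F) <= \sum_i pr P (A `&` B i).
Proof.
move=> t0 mA mF mB HF.
have mAF : measurable (A `&` F) by exact: measurableI.
have mAB i : measurable (A `&` B i) by exact: measurableI.
rewrite -lee_fin EFinM -sumEFin -prE//.
under eq_bigr do rewrite -prE// -(setIT (A `&` _)) -integral_indic//.
rewrite -(setIT (A `&` F)) -integral_indic// -ge0_integralZl_EFin//; last first.
  by apply/measurable_EFinP; exact: measurable_indic.
have mi i : measurable_fun setT (fun w => (\1_(A `&` B i) w)%:E : \bar R).
  by apply/measurable_EFinP; exact: measurable_indic.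
rewrite -ge0_integral_sum//; last first.
apply: ge0_le_integral => //.
- by move=> w _; rewrite mule_ge0// lee_fin.
- by apply: emeasurable_funM => //; apply/measurable_EFinP; exact: measurable_indic.
- exact: emeasurable_sum.
move=> w _; rewrite sumEFin -EFinM lee_fin.
have E C : \1_(A `&` C) w = \1_A w * \1_C w :> R by rewrite indicI.
under eq_bigr do rewrite E.
rewrite E -mulr_sumr mulrCA; have [wF|wF] := boolP (w \in F).
  rewrite ler_wpM2l ?indicE ?ler0n//; rewrite wF mulr1.
  have := HF w; rewrite inE in wF => /(_ wF).
  by under eq_bigr do rewrite indicE.
rewrite [X in _ * (_ * X)]indicE (negbTE wF) !mulr0 mulr_ge0 ?indicE ?ler0n//.
by apply: sumr_ge0 => i _; rewrite indicE ler0n.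
Qed.

(** Bernoulli's inequality in the form (1 - u)^n (1 + n u) <= 1, in place of an exponential
    estimate. *)
Lemma expr_subr1_le (R : realFieldType) (u e : R) n : 0 <= u <= 1 -> 0 < e ->
  e^-1 <= n%:R * u -> (1 - u) ^+ n <= e.
Proof.
move=> /andP[u0 u1] e0 nu.
have H : (1 - u) ^+ n * (1 + n%:R * u) <= 1.
  elim: n {nu} => [|n IH]; first by rewrite expr0 mul0r addr0 mulr1.
  apply: le_trans IH; rewrite exprSr -mulrA ler_wpM2l ?exprn_ge0 ?subr_ge0//.
  rewrite -natr1; have : 0 <= n%:R :> R by []. 
  by move: (n%:R : R) => y; nra.
have h : e^-1 <= 1 + n%:R * u by rewrite (le_trans nu)// lerDr.
have : (1 - u) ^+ n * e^-1 <= 1.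
  by apply: le_trans H; rewrite ler_wpM2l ?exprn_ge0 ?subr_ge0.
by rewrite ler_pdivrMr// mul1r.
Qed.

Section lower_asymptotics.
Context d (T : measurableType d) (R : realType) (P : probability T R).
Context (xi : nat -> T -> int) (zeta : int -> T -> R).
Hypothesis mxi : forall k, measurable_fun setT (xi k).
Hypothesis xi_indep : mutually_independent P xi.
Hypothesis xi_ident : identically_distributed P xi.
Hypothesis xi_sym : symmetric_law P (xi 0%N).
Hypothesis mzeta : forall k, measurable_fun setT (zeta k).
Hypothesis zeta_pos : forall k w, 0 < zeta k w.
Hypothesis zeta_indep : mutually_independent P zeta.
Hypothesis zeta_ident : identically_distributed P zeta.
Hypothesis S_zeta_indep : independent_processes P (walk xi) zeta.

Local Notation S := (walk xi).
Local Notation Y := (walk_on_medium S (medium zeta)).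
Local Notation L := (ladder_length (@ladder_time R T S) Y).
Local Notation dY := (increment xi zeta).
Local Notation p := (pr P (xi 0%N @^-1` [set z | z < 0])).
Hypothesis p_gt0 : 0 < p.

Let quiet_bound N K r M x : (N <= K)%N ->
  pr P (stay xi N `&` quiet xi zeta K r x) <=
  ((1 - jump_prob P xi M) ^+ r + (1 - bond_tail P zeta x) ^+ M) * stay_prob P xi N.
Proof. by move=> NK; apply: pr_stay_quiet. Qed.

Let tail_ge := @ladder_tail_ge _ _ _ _ _ zeta mxi xi_indep xi_ident xi_sym mzeta p_gt0.

Lemma jump_prob01 M : 0 <= jump_prob P xi M <= 1.
Proof. by rewrite pr_ge0 pr_le1//; exact: measurable_step. Qed.

Lemma bond_tail01 x : 0 <= bond_tail P zeta x <= 1.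
Proof. by rewrite pr_ge0 pr_le1//; exact: measurable_bond_gt. Qed.

Lemma sum_increment_block K r x w : ~ quiet xi zeta K r x w ->
  x < \sum_(K <= k < K + r) dY k w.
Proof.
move=> nq; have [k kKr xk] : exists2 k, (K <= k < K + r)%N & x < dY k w.
  apply: contra_notP nq => H k /= kKr; rewrite leNgt; apply/negP => xk.
  by apply: H; exists k.
rewrite (bigD1_seq k) ?iota_uniq ?mem_index_iota//= (lt_le_trans xk)// lerDl.
by apply: sumr_ge0 => j _; exact: increment_ge0.
Qed.

Lemma ladder_length_gt_sum N w : stay xi N.*2 w ->
  ((\sum_(N <= k < N + N) dY k w)%:E <= L w)%E.
Proof.
move=> ws; apply: le_trans (ladder_length_ge zeta ws); rewrite lee_fin.
rewrite -(big_mkord xpredT (fun k => dY k w)).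
have [h1 h2 h3] : [/\ (N <= N.*2.+1)%N, (N <= N + N)%N & (N + N <= N.*2.+1)%N].
  by split; lia.
rewrite (big_cat_nat (leq0n N) h1) (big_cat_nat h2 h3)/= addrCA lerDl.
by rewrite addr_ge0//; apply: sumr_ge0 => j _; exact: increment_ge0.
Qed.

(** The interval [N, 2N) is cut into m blocks of fixed length r, each likely to contain an increment
    above delta. With at least half of the blocks successful the length exceeds x as soon as m delta
    / 2 >= x. *)
Lemma ladder_tail_ge_half :
  exists2 c, 0 < c & forall x, 1 <= x ->
    c * x `^ (- (1 / 2)) <= pr P [set w | (x%:E < L w)%E].
Proof.
pose u := jump_prob P xi 1.
have u0 : 0 < u.
  apply: lt_le_trans p_gt0 _; apply: le_pr; [exact: measurable_step|exact: measurable_step|].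
  by move=> w /=; rewrite absz_gt0; apply: contraTneq => ->; rewrite ltxx.
have e0 : 0 < p / 64 by rewrite divr_gt0.
(* Long enough for a block to consist of zero steps only with probability at most p / 64. *)
pose r := (Num.truncn ((p / 64)^-1 / u)).+1.
have r_le : (1 - u) ^+ r <= p / 64.
  apply: expr_subr1_le => //; first exact: jump_prob01.
  by rewrite -ler_pdivrMr// ltW// truncnS_gt.
(* Here positivity of the bonds enters: the events zeta <= 1 / (n + 1) decrease to the empty set. *)
have [delta d0 dP] : exists2 delta : R, 0 < delta & 1 - bond_tail P zeta delta <= p / 64.
  pose F n := ~` [set w | n.+1%:R^-1 < zeta 1 w].
  have mF n : measurable (F n) by apply: measurableC; exact: measurable_bond_gt.
  have dF m n : (m <= n)%N -> F n `<=` F m.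
    move=> mn w; apply: contra_not => /=; apply: le_lt_trans.
    by rewrite lef_pV2 ?posrE// ler_nat.
  have F0 : \bigcap_n F n = set0.
    apply/seteqP; split => // w /(_ (Num.truncn (zeta 1 w)^-1) I); apply => /=.
    by rewrite invf_plt ?posrE// truncnS_gt.
  have [n Fn] := pr_cvg0 P mF dF F0 e0.
  exists n.+1%:R^-1 => //; rewrite -prC ?ltW//.
  exact: measurable_bond_gt.
have key m x : (0 < m)%N -> x <= delta * (m%:R / 2) ->
    Num.sqrt p / 16 / Num.sqrt (m * r).+1%:R <= pr P [set w | (x%:E < L w)%E].
  move=> m0 xm; set N := (m * r)%N.
  pose B (i : 'I_m) := quiet xi zeta (N + i * r) r delta.
  have mB i : measurable (B i) by exact: measurable_quiet.
  (* At least half of the blocks fail. Each does so with relative probability at most p / 64 + p /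
     64, so Markov at level m / 2 gives p / 16. *)
  pose F := ~` [set w | \sum_i \1_(B i) w < m%:R / 2 :> R].
  have mF : measurable F.
    apply: measurableC; apply: (measurable_lt (g := cst (m%:R / 2))) => //.
    by apply: measurable_sum => i; exact: measurable_indic.
  apply: (tail_ge mF).
    have mR0 : 0 < m%:R / 2 :> R by rewrite divr_gt0// ltr0n.
    rewrite -(ler_pM2l mR0).
    apply: (le_trans (count_pr_le P (B := B) (ltW mR0) _ _ _ _)) => //.
    - exact: measurable_stay.
    - by move=> w /negP; rewrite -leNgt.
    have -> : m%:R / 2 * (p / 16 * stay_prob P xi N) =
      \sum_(i < m) (p / 64 + p / 64) * stay_prob P xi N.
      by rewrite sumr_const card_ord -[RHS]mulr_natl; field.
    apply: ler_sum => i _.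
    apply: (le_trans (quiet_bound r 1 delta (leq_addr _ _))).
    by rewrite ler_wpM2r ?pr_ge0// expr1 lerD.
  move=> w ws /contrapT nF.
  apply: lt_le_trans (ladder_length_gt_sum ws); rewrite lte_fin (le_lt_trans xm)//.
  have H j : (j <= m)%N -> \sum_(i < m | (i < j)%N) delta * (1 - \1_(B i) w) <=
      \sum_(N <= k < N + j * r) dY k w.
    elim: j => [_|j IH jm]; first by rewrite big_pred0_eq mul0n addn0 big_geq.
    have hj : (N + j * r <= N + j.+1 * r)%N by rewrite leq_add2l leq_mul2r leqnSn orbT.
    rewrite (big_cat_nat (leq_addr _ _) hj)/=.
    rewrite (bigD1 (Ordinal jm)) ?ltnSn//= addrC lerD//.
      apply: le_trans (IH (ltnW jm)); rewrite le_eqVlt; apply/orP; left; apply/eqP.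
      apply: eq_bigl => i; rewrite ltnS -val_eqE/=; lia.
    rewrite mulSn [(r + _)%N]addnC addnA indicE; have [wB|wB] := boolP (w \in _).
      by rewrite subrr mulr0; apply: sumr_ge0 => k _; exact: increment_ge0.
    rewrite subr0 mulr1 ltW//; apply: sum_increment_block => wq.
    by move/negP : wB; apply; rewrite inE.
  apply: lt_le_trans (H m (leqnn _)).
  rewrite (eq_bigl xpredT) => [|i]; last by rewrite ltn_ord.
  rewrite -mulr_sumr ltr_pM2l// sumrB sumr_const card_ord.
  by move: nF => /=; lra.
(* A bound for (m r + 1) / x when m is about 2 x / delta and x >= 1. *)
pose C := (2 / delta + 1) * r%:R + 1.
have C0 : 0 < C by rewrite ltr_wpDl// mulr_ge0// addr_ge0// divr_ge0// ltW.
exists (Num.sqrt p / 16 / Num.sqrt C).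
  by rewrite !divr_gt0// sqrtr_gt0.
move=> x x1; have x0 : 0 < x by exact: lt_le_trans x1.
pose m := (Num.truncn (2 * x / delta)).+1.
have xd0 : 0 <= 2 * x / delta by rewrite divr_ge0 ?mulr_ge0// ltW.
apply: le_trans (key m x _ _) => //; last first.
  have : 2 * x / delta < m%:R by rewrite truncnS_gt.
  by rewrite ltr_pdivrMr//; lra.
have -> : x `^ (- (1 / 2)) = (Num.sqrt x)^-1 by rewrite powRN mul1r powR12_sqrt// ltW.
rewrite -[leLHS](mulrA (Num.sqrt p / 16)) ler_wpM2l ?divr_ge0 ?sqrtr_ge0//.
rewrite -invfM -sqrtrM ?(ltW C0)//.
rewrite lef_pV2 ?posrE ?sqrtr_gt0 ?mulr_gt0// ler_sqrt ?mulr_ge0 ?(ltW C0) ?(ltW x0)//.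
have mx : m%:R <= (2 / delta + 1) * x.
  have : (Num.truncn (2 * x / delta))%:R <= 2 * x / delta.
    by have /andP[] := truncn_itv xd0.
  by rewrite -[m%:R]natr1; lra.
rewrite -[(m * r).+1%:R]natr1 natrM.
by have := ler_wpM2r (ler0n R r) mx; rewrite /C; lra.
Qed.

(** A single block of N steps is used: M of order x^gamma makes a bond above x likely among M, and N
    of order M^beta makes a jump of size at least M likely among N steps. *)
Lemma ladder_tail_ge_stable (beta gamma c1 c2 x0 : R) (M0 : nat) :
  0 < beta -> 0 < gamma -> 0 < c1 -> 0 < c2 ->
  (forall M, (M0 <= M)%N -> (0 < M)%N -> c1 <= jump_prob P xi M * M%:R `^ beta) ->
  (forall x, x0 <= x -> 1 <= x -> c2 <= bond_tail P zeta x * x `^ gamma) ->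
  exists2 c, 0 < c & forall x, x0 <= x -> 1 <= x ->
    c * x `^ (- (gamma * beta / 2)) <= pr P [set w | (x%:E < L w)%E].
Proof.
move=> b0 g0 c10 c20 jumpP bondP.
have e0 : 0 < p / 32 by rewrite divr_gt0.
(* These bring M P(zeta > x) and N P(|xi| >= M) to at least 32 / p, so that by [expr_subr1_le] each
   failure costs at most p / 32. *)
pose A2 := (p / 32)^-1 / c2; pose A1 := (p / 32)^-1 / c1.
have A20 : 0 < A2 by rewrite divr_gt0// invr_gt0.
have A10 : 0 < A1 by rewrite divr_gt0// invr_gt0.
pose C2 := A2 + 1 + M0%:R.
have C20 : 0 < C2 by rewrite /C2 ltr_wpDr// addr_gt0.
pose C1 := A1 * C2 `^ beta + 2.
have C10 : 0 < C1 by rewrite addr_gt0// mulr_gt0// powR_gt0.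
exists (Num.sqrt p / 16 / Num.sqrt C1).
  by rewrite !divr_gt0// sqrtr_gt0.
move=> x xx0 x1; have xp : 0 < x by exact: lt_le_trans x1.
have xg1 : 1 <= x `^ gamma.
  by have := ler_powR x1 (ltW g0); rewrite powRr0.
have xg0 : 0 < x `^ gamma by exact: lt_le_trans xg1.
pose M := ((Num.truncn (A2 * x `^ gamma)).+1 + M0)%N.
have A2x : 0 <= A2 * x `^ gamma by rewrite mulr_ge0// ltW.
have M_gt0 : (0 < M)%N by [].
have M_ge : A2 * x `^ gamma <= M%:R.
  by rewrite (le_trans (ltW (truncnS_gt _)))// ler_nat leq_addr.
have M_le : M%:R <= C2 * x `^ gamma.
  have h : (Num.truncn (A2 * x `^ gamma))%:R <= A2 * x `^ gamma.
    by have /andP[] := truncn_itv A2x.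
  rewrite /M natrD -[_.+1%:R]natr1.
  have : (M0%:R : R) <= M0%:R * x `^ gamma by rewrite ler_peMr.
  by rewrite /C2; lra.
have MR0 : 0 < M%:R :> R by rewrite ltr0n.
have Mb0 : 0 < M%:R `^ beta :> R by rewrite powR_gt0.
pose N := (Num.truncn (A1 * M%:R `^ beta)).+1.
have A1M : 0 <= A1 * M%:R `^ beta by rewrite mulr_ge0// ltW.
have N_ge : A1 * M%:R `^ beta <= N%:R by rewrite ltW// truncnS_gt.
have xgb1 : 1 <= x `^ (gamma * beta).
  by have := ler_powR x1 (ltW (mulr_gt0 g0 b0)); rewrite powRr0.
have N_le : N.+1%:R <= C1 * x `^ (gamma * beta).
  have h : (Num.truncn (A1 * M%:R `^ beta))%:R <= A1 * M%:R `^ beta.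
    by have /andP[] := truncn_itv A1M.
  have h2 : M%:R `^ beta <= C2 `^ beta * x `^ (gamma * beta).
    rewrite powRrM -powRM ?(ltW C20) ?powR_ge0//.
    by rewrite ge0_ler_powR ?nnegrE ?(ltW b0)// mulr_ge0 ?powR_ge0// ltW.
  have h3 := ler_wpM2l (ltW A10) h2.
  by rewrite /N -[_.+2%:R]natr1 -[_.+1%:R]natr1 /C1; lra.
have small1 : (1 - jump_prob P xi M) ^+ N <= p / 32.
  apply: expr_subr1_le => //; first exact: jump_prob01.
  apply: (@le_trans _ _ (A1 * (jump_prob P xi M * M%:R `^ beta))).
    rewrite /A1 -mulrA ler_peMr ?invr_ge0 ?(ltW e0)// mulrC ler_pdivlMr// mul1r.
    by apply: jumpP => //; rewrite leq_addl.
  rewrite mulrCA mulrC ler_wpM2r//; by case/andP: (jump_prob01 M).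
have small2 : (1 - bond_tail P zeta x) ^+ M <= p / 32.
  apply: expr_subr1_le => //; first exact: bond_tail01.
  apply: (@le_trans _ _ (A2 * (bond_tail P zeta x * x `^ gamma))).
    rewrite /A2 -mulrA ler_peMr ?invr_ge0 ?(ltW e0)// mulrC ler_pdivlMr// mul1r.
    exact: bondP.
  rewrite mulrCA mulrC ler_wpM2r//; by case/andP: (bond_tail01 x).
have mq := measurable_quiet mxi mzeta N N x.
apply: le_trans (tail_ge (N := N) mq _ _).
- have -> : x `^ (- (gamma * beta / 2)) = (Num.sqrt (x `^ (gamma * beta)))^-1.
    by rewrite powRN powRrM powR12_sqrt// powR_ge0.
  rewrite -[leLHS](mulrA (Num.sqrt p / 16)) ler_wpM2l ?divr_ge0 ?sqrtr_ge0//.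
  rewrite -invfM -sqrtrM ?(ltW C10)//.
  have xgb0 : 0 < x `^ (gamma * beta) by exact: lt_le_trans xgb1.
  by rewrite lef_pV2 ?posrE ?sqrtr_gt0 ?mulr_gt0// ler_sqrt ?mulr_ge0 ?(ltW C10) ?(ltW xgb0).
- apply: (le_trans (quiet_bound N M x (leqnn N))).
  rewrite ler_wpM2r ?pr_ge0// (_ : p / 16 = p / 32 + p / 32); first exact: lerD.
  by field.
- move=> w ws wq; apply: lt_le_trans (ladder_length_gt_sum ws).
  by rewrite lte_fin; exact: sum_increment_block.
Qed.

End lower_asymptotics.

Lemma powRV (R : realType) (x r : R) : 0 <= x -> x^-1 `^ r = (x `^ r)^-1.
Proof. by move=> x0; rewrite -powR_inv1// -powRrM mulN1r powRN. Qed.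

Lemma slowly_varying_cst (R : realType) (c : R) : 0 < c -> slowly_varying (cst c).
Proof.
move=> c0; split => //; first exact: nearW.
by move=> a a0; rewrite /= divff ?gt_eqF//; exact: cvg_cst.
Qed.

Lemma slowly_varying_ln (R : realType) (c : R) : 0 < c ->
  slowly_varying (fun x => c * ln x).
Proof.
move=> c0; split.
- by apply: measurable_funM => //; exact: measurable_ln.
- near=> x; rewrite mulr_gt0// ln_gt0//; near: x; exact: nbhs_pinfty_gt.
move=> a a0; apply/cvgrPdist_lt => e e0.
near=> x.
have x1 : 1 < x by near: x; exact: nbhs_pinfty_gt.
have x0 : 0 < x by exact: lt_trans x1.
have lx : 0 < ln x by rewrite ln_gt0.
rewrite lnM ?posrE//.
have -> : 1 - c * (ln a + ln x) / (c * ln x) = - (ln a / ln x).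
  by field; rewrite !gt_eqF.
rewrite normrN normrM normfV (gtr0_norm lx) ltr_pdivrMr// mulrC -ltr_pdivrMr//.
rewrite -ltr_expR lnK ?posrE//; near: x; exact: nbhs_pinfty_gt.
Unshelve. all: by end_near.
Qed.

(** * Upper bound in powers of x *)

Section upper_asymptotics.
Context d (T : measurableType d) (R : realType) (P : probability T R).
Context (xi : nat -> T -> int) (zeta : int -> T -> R).
Hypothesis mxi : forall k, measurable_fun setT (xi k).
Hypothesis xi_indep : mutually_independent P xi.
Hypothesis xi_ident : identically_distributed P xi.
Hypothesis xi_sym : symmetric_law P (xi 0%N).
Hypothesis mzeta : forall k, measurable_fun setT (zeta k).
Hypothesis zeta_pos : forall k w, 0 < zeta k w.
Hypothesis zeta_ident : identically_distributed P zeta.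
Hypothesis S_zeta_indep : independent_processes P (walk xi) zeta.

Local Notation S := (walk xi).
Local Notation Y := (walk_on_medium S (medium zeta)).
Local Notation L := (ladder_length (@ladder_time R T S) Y).
Local Notation p := (pr P (xi 0%N @^-1` [set z | z < 0])).
Local Notation stepX := (@stepR _ _ R xi).
Hypothesis p_gt0 : 0 < p.

Lemma measurable_stepR : measurable_fun setT stepX.
Proof. exact: (measurable_int (fun z => z%:~R)). Qed.

Context (g D : R).
Hypotheses (g_gt0 : 0 < g) (D_gt0 : 0 < D).
Hypothesis bond_le : forall x : R, 1 <= x ->
  trunc_moment1 P (zeta 1) x^-1 <= D * x `^ (- g).

(** Taking n of order x^g makes a_n of order x^(-g/2) and the sum of the a_k of order x^(g/2); what
    remains is the truncated mean of a step at scale x^(-g). *)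
Lemma ladder_tail_le_moment x : 1 <= x ->
  pr P [set w | (x%:E < L w)%E] <= (Num.sqrt p)^-1 *
    (x `^ (- (g / 2)) + 4 * x `^ (g / 2) * trunc_moment1 P stepX (D * x `^ (- g))).
Proof.
move=> x1; have x0 : 0 < x by exact: lt_le_trans x1.
have xg1 : 1 <= x `^ g by have := ler_powR x1 (ltW g_gt0); rewrite powRr0.
have xg0 : 0 < x `^ g by exact: lt_le_trans xg1.
pose n := (Num.truncn (x `^ g)).+1.
have n_ge : x `^ g <= n%:R by rewrite ltW// truncnS_gt.
(* The factor 2 would do; 4 has an integer square root. *)
have n_le : n%:R <= 4 * x `^ g.
  have h : (Num.truncn (x `^ g))%:R <= x `^ g.
    by have /andP[] := truncn_itv (ltW xg0).
  by rewrite /n -natr1; lra.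
have sE : Num.sqrt (x `^ g) = x `^ (g / 2) by rewrite powRrM powR12_sqrt// powR_ge0.
have s0 : 0 < x `^ (g / 2) by rewrite powR_gt0.
have sp : 0 < (Num.sqrt p)^-1 by rewrite invr_gt0 sqrtr_gt0.
apply: (le_trans (ladder_length_tail_le mxi xi_indep xi_ident mzeta zeta_pos
  zeta_ident S_zeta_indep n x0)).
rewrite mulrDr lerD//.
  apply: (le_trans (stay_prob_le mxi xi_indep xi_ident xi_sym p_gt0 n)).
  rewrite ler_wpM2l ?(ltW sp)// powRN lef_pV2 ?posrE ?sqrtr_gt0//.
  by rewrite -sE ler_sqrt// (le_trans n_ge)// ler_nat.
rewrite mulrA ler_pM//.
- by apply: sumr_ge0 => k _; exact: pr_ge0.
- by apply: Rintegral_ge0 => w _; rewrite le_min ler01/=.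
- apply: (le_trans (sum_stay_prob_le mxi xi_indep xi_ident xi_sym p_gt0 n)).
  have : Num.sqrt n%:R <= 2 * x `^ (g / 2).
    rewrite -sE -[2](_ : Num.sqrt (2 ^+ 2) = 2); last by rewrite sqrtr_sqr ger0_norm.
    rewrite -sqrtrM ?exprn_ge0// ler_sqrt ?mulr_ge0 ?exprn_ge0 ?(ltW xg0)//.
    by rewrite (le_trans n_le)//; lra.
  by move=> /(ler_wpM2l (ltW sp)); lra.
- apply: (trunc_moment1_mono P measurable_stepR).
  by rewrite bond_le// andbT; apply: Rintegral_ge0 => w _; rewrite le_min ler01/=.
Qed.

Let powR_half x : 0 < x -> x `^ (g / 2) * x `^ (- g) = x `^ (- (g / 2)).
Proof.
move=> x0; rewrite -powRD; last by rewrite (gt_eqF x0) implybT.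
by congr (_ `^ _); field.
Qed.

Lemma ladder_tail_le_linear (G : R) : 0 < G ->
  (forall t, 0 < t -> trunc_moment1 P stepX t <= G * t) ->
  exists2 c, 0 < c & forall x, 1 <= x ->
    pr P [set w | (x%:E < L w)%E] <= c * x `^ (- (g / 2)).
Proof.
move=> G0 HG; have sp : 0 < (Num.sqrt p)^-1 by rewrite invr_gt0 sqrtr_gt0.
exists ((Num.sqrt p)^-1 * (1 + 4 * G * D)).
  by rewrite mulr_gt0// addr_gt0// !mulr_gt0.
move=> x x1; have x0 : 0 < x by exact: lt_le_trans x1.
apply: (le_trans (ladder_tail_le_moment x1)).
rewrite -[leRHS]mulrA ler_wpM2l ?(ltW sp)// [leRHS]mulrDl mul1r lerD2l.
have h : 0 < D * x `^ (- g) by rewrite mulr_gt0// powR_gt0.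
apply: (@le_trans _ _ (4 * x `^ (g / 2) * (G * (D * x `^ (- g))))).
  by rewrite ler_wpM2l ?HG// mulr_ge0// powR_ge0.
by rewrite -(powR_half x0) le_eqVlt; apply/orP; left; apply/eqP; ring.
Qed.

Lemma ladder_tail_le_log (G : R) : 0 < G ->
  (forall t, 0 < t <= 1 -> trunc_moment1 P stepX t <= G * t * (1 - ln t)) ->
  exists2 c, 0 < c & \forall x \near +oo,
    pr P [set w | (x%:E < L w)%E] <= c * ln x * x `^ (- (g / 2)).
Proof.
move=> G0 HG; have sp : 0 < (Num.sqrt p)^-1 by rewrite invr_gt0 sqrtr_gt0.
(* For ln x >= 1 this dominates (1 - ln(D x^(-g))) / ln x. *)
pose E := `|1 - ln D| + g.
have E0 : 0 < E by rewrite ltr_wpDl.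
exists ((Num.sqrt p)^-1 * (1 + 4 * G * D * E)).
  by rewrite mulr_gt0// addr_gt0// !mulr_gt0.
near=> x.
have x1 : 1 <= x by near: x; exact: nbhs_pinfty_ge.
have lx : 1 <= ln x.
  by rewrite -[leLHS]expRK ler_ln ?posrE ?expR_gt0 ?(lt_le_trans _ x1).
have x0 : 0 < x by exact: lt_le_trans x1.
(* The logarithmic moment bound is available only on (0, 1], whence x >= D^(1/g). *)
have Dx : D * x `^ (- g) <= 1.
  rewrite powRN ler_pdivrMr ?powR_gt0// mul1r.
  have -> : D = (D `^ g^-1) `^ g by rewrite -powRrM mulVf ?gt_eqF// powRr1 ?(ltW D_gt0).
  by rewrite ge0_ler_powR ?nnegrE ?powR_ge0 ?(ltW g_gt0) ?(ltW x0).
apply: (le_trans (ladder_tail_le_moment x1)).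
rewrite -[_ * _ * ln x]mulrA -[leRHS]mulrA ler_wpM2l ?(ltW sp)//.
have xg := powR_gt0 (- (g / 2)) x0.
have h : 0 < D * x `^ (- g) by rewrite mulr_gt0// powR_gt0.
have := HG (D * x `^ (- g)); rewrite h Dx => /(_ isT).
rewrite lnM ?posrE ?powR_gt0// ln_powR => HGx.
have l1 : 1 - (ln D + - g * ln x) <= E * ln x.
  rewrite /E mulrDl; have : `|1 - ln D| <= `|1 - ln D| * ln x by rewrite ler_peMr.
  by have := ler_norm (1 - ln D); lra.
have l2 : trunc_moment1 P stepX (D * x `^ (- g)) <= G * (D * x `^ (- g)) * (E * ln x).
  by rewrite (le_trans HGx)// ler_wpM2l// mulr_ge0// ltW.
have l3 : 4 * x `^ (g / 2) * trunc_moment1 P stepX (D * x `^ (- g)) <=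
    4 * G * D * E * (ln x * x `^ (- (g / 2))).
  apply: (@le_trans _ _ (4 * x `^ (g / 2) * (G * (D * x `^ (- g)) * (E * ln x)))).
    by rewrite ler_wpM2l// mulr_ge0// powR_ge0.
  by rewrite -(powR_half x0) le_eqVlt; apply/orP; left; apply/eqP; ring.
have l4 : x `^ (- (g / 2)) <= ln x * x `^ (- (g / 2)) by rewrite ler_peMl// ltW.
rewrite mulrA in l3; lra.
Unshelve. all: by end_near.
Qed.

End upper_asymptotics.

Lemma Rintegral_min_expectation d (T : measurableType d) (R : realType)
  (P : probability T R) (X : {RV P >-> R}) (mu t : R) :
  (forall w, 0 < X w) -> 0 <= t -> ('E_P[X] = mu%:E)%E ->
  trunc_moment1 P X t <= t * mu.
Proof.
move=> X0 t0 EX; have mX : measurable_fun setT X by [].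
rewrite -lee_fin -trunc_moment1E// EFinM -EX unlock.
rewrite -ge0_integralZl_EFin//; last 2 first.
- by move=> w _; rewrite lee_fin ltW.
- exact/measurable_EFinP.
apply: ge0_le_integral => //.
- apply/measurable_EFinP; apply: measurable_minr => //; apply: measurableT_comp => //.
  exact: measurable_funM.
- by apply/measurable_EFinP; exact: measurable_funM.
- move=> w _; rewrite -EFinM lee_fin ger0_norm; last by rewrite mulr_ge0// ltW.
  by rewrite ge_min lexx orbT.
Qed.

Theorem corollary2p4 (R : realType) (d : measure_display)
    (T : measurableType d) (P : probability T R) (beta gamma : R)
    (xi : nat -> {RV P >-> int}) (zeta : int -> {RV P >-> R})
    (beta_range : 1 <= beta < 2)
    (gamma_range : 0 < gamma <= 2) (gamma_neq1 : gamma != 1)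
    (xi_indep : mutually_independent P (fun k => xi k : T -> int))
    (xi_ident : identically_distributed P (fun k => xi k : T -> int))
    (xi_basin : symmetric_stable_basin P (xi 0%N) beta)
    (zeta_indep : mutually_independent P (fun k => zeta k : T -> R))
    (zeta_ident : identically_distributed P (fun k => zeta k : T -> R))
    (zeta_pos : forall k w, 0 < zeta k w)
    (zeta_basin : stable_basin P (fun k => zeta k : T -> R) gamma)
    (S_zeta_indep : independent_processes P
       (walk (fun k => xi k : T -> int)) (fun k => zeta k : T -> R)) :
  let S := walk (fun k => xi k : T -> int) in
  let Y := walk_on_medium S (medium (fun k => zeta k : T -> R)) in
  let L := ladder_length (@ladder_time R T S) Y in
  let gammahat := Num.min 1 gamma in
  exists Klow Kup : R -> R,
    [/\ beta != 1 -> (exists2 c, 0 < c & Klow = cst c) /\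
                     (exists2 c, 0 < c & Kup = cst c),
        beta = 1 -> slowly_varying Klow /\ slowly_varying Kup &
        \forall x \near +oo,
          ((Klow x * x `^ (- Num.min (1 / 2) (gammahat * beta / 2)))%:E
             <= P [set w | x%:E < L w]
             <= (Kup x * x `^ (- (gammahat / 2)))%:E)%E].
Proof.
move=> S Y L gammahat.
have [b1 b2] := andP beta_range; have [g0 g2] := andP gamma_range.
have b0 : 0 < beta by exact: lt_le_trans b1.
have b02 : 0 < beta < 2 by rewrite b0.
pose xi' k : T -> int := xi k; pose zeta' k : T -> R := zeta k.
have mxi k : measurable_fun setT (xi' k) by exact: measurable_funPT.
have mzeta k : measurable_fun setT (zeta' k) by exact: measurable_funPT.
have mstep : measurable_fun setT (stepR R xi') by exact: measurable_stepR.
have [xi_sym [nu nu0 xi_charf]] := xi_basin.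
have [s0 s00 xi_defect] : exists2 s0 : R, 0 < s0 & forall s : R, 0 < s < s0 ->
    nu / 2 * s `^ beta <= charf_defect P (stepR R xi') s <= 2 * nu * s `^ beta.
  apply: (charf_defect_asymp mstep nu0 _ xi_charf).
  by move=> s.
have nu20 : 0 < nu / 2 by rewrite divr_gt0.
have [c1 c10 [t0 t00 xi_tail]] := tail_ge mstep b02 nu20 s00 xi_defect.
(* For M >= M0 the tail estimate applies at t = 1 / M. *)
pose M0 := (Num.truncn t0^-1).+1.
have jumpP M : (M0 <= M)%N -> (0 < M)%N -> c1 <= jump_prob P xi' M * M%:R `^ beta.
  move=> M0M M_gt0; have MR0 : 0 < M%:R :> R by rewrite ltr0n.
  rewrite -ler_pdivrMr ?powR_gt0// -powRV ?(ltW MR0)//.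
  apply: le_trans (xi_tail M%:R^-1 _) _.
    rewrite invr_gt0 MR0/= invf_plt ?posrE//.
    by rewrite (lt_le_trans (truncnS_gt _))// ler_nat.
  apply: le_pr.
  - apply: (measurable_lt (f := cst 1)) => //; apply: measurableT_comp => //.
    exact: measurable_funM.
  - exact: measurable_step.
  move=> w /=; rewrite normrM gtr0_norm ?invr_gt0// mulrC ltr_pdivlMr// mul1r.
  by rewrite /stepR -intr_norm -natr_absz ltr_nat => /ltnW.
(* Otherwise, by symmetry, the step would vanish almost surely, against the lower bound on its
   tail. *)
have p_gt0 : 0 < pr P (xi' 0%N @^-1` [set z | z < 0]).
  rewrite lt_neqAle pr_ge0 andbT eq_sym; apply/negP => /eqP p0.
  have p0' : pr P (xi' 0%N @^-1` [set z | 0 < z]) = 0.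
    rewrite -p0 -[X in pr P X](_ : steps xi' [:: 0%N] @^-1`
        [set s | head 0 (map -%R s) < 0] = _); last first.
      by apply/seteqP; split => w /=; rewrite oppr_lt0.
    exact: (@pr_steps_opp _ _ _ P xi' mxi xi_indep xi_ident xi_sym [:: 0%N]
      [set s | head 0 s < 0]).
  have := jumpP M0 (leqnn _) isT; apply/negP; rewrite -ltNge.
  rewrite (_ : jump_prob _ _ _ = 0) ?mul0r//.
  apply/le_anti; rewrite pr_ge0 andbT -[leRHS]addr0 -{1}p0 -p0'.
  apply: le_trans (prU_le _ _ _); [|exact: measurable_step|exact: measurable_step].
  apply: le_pr; [exact: measurable_step| |].
    by apply: measurableU; exact: measurable_step.
  by move=> w /=; case: (ltgtP (xi' 0%N w) 0) => [|_ _|->]//; [left|right].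
have gh0 : 0 < gammahat by rewrite lt_min ltr01.
have zeta_stable : gamma < 1 ->
    (exists2 D : R, 0 < D & forall t : R, 0 < t ->
      trunc_moment1 P (zeta' 1) t <= D * t `^ gamma) /\
    exists2 c : R, 0 < c & exists2 t1 : R, 0 < t1 & forall t, 0 < t < t1 ->
      c * t `^ gamma <= pr P [set w | 1 < `|t * zeta' 1 w|].
  move=> g1; have [c c0 zeta_charf] := zeta_basin.1 g1.
  have g02 : 0 < gamma < 2 by rewrite g0 (lt_trans g1)// ltr1n.
  (* As gamma < 1, the angle is below pi / 2, so the real part of the expansion has a genuine term
     of order s^gamma. *)
  have k0 : 0 < c * cos (pi * gamma / 2).
    rewrite mulr_gt0// cos_gt0_pihalf//; have := pi_gt0 R => pi0.
    by apply/andP; split; nra.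
  have [s1 s10 zeta_defect] : exists2 s1 : R, 0 < s1 & forall s : R, 0 < s < s1 ->
      c * cos (pi * gamma / 2) / 2 * s `^ gamma <= charf_defect P (zeta' 1) s <=
      2 * (c * cos (pi * gamma / 2)) * s `^ gamma.
    apply: (charf_defect_asymp (mzeta 1) k0 _ zeta_charf) => s.
    by rewrite /expi /= cosN; ring.
  have k20 : 0 < c * cos (pi * gamma / 2) / 2 by rewrite divr_gt0.
  split; first exact: (trunc_moment1_bound_lt1 (mzeta 1) g02 k20 s10 zeta_defect).
  exact: (tail_ge (mzeta 1) g02 k20 s10 zeta_defect).
have [D D0 bond_le] : exists2 D : R, 0 < D & forall x : R, 1 <= x ->
    trunc_moment1 P (zeta' 1) x^-1 <= D * x `^ (- gammahat).
  have [g1|g1|/eqP] := ltgtP gamma 1; last by rewrite (negbTE gamma_neq1).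
    have [[D D0 HD] _] := zeta_stable g1; exists D => // x x1.
    have x0 : 0 < x by exact: lt_le_trans x1.
    rewrite /gammahat (min_idPr (ltW g1)) powRN -powRV ?(ltW x0)//.
    by apply: HD; rewrite invr_gt0.
  have [_ [mu [mu0 Ezeta _]]] := zeta_basin.2 g1.
  exists mu => // x x1; have x0 : 0 < x by exact: lt_le_trans x1.
  rewrite /gammahat (min_idPl (ltW g1)) powR_inv1 ?(ltW x0)// mulrC.
  by apply: (Rintegral_min_expectation (zeta_pos 1)) => //; rewrite invr_ge0 ltW.
have [cl cl0 lowP] : exists2 c : R, 0 < c & \forall x \near +oo,
    c * x `^ (- Num.min (1 / 2) (gammahat * beta / 2)) <=
    pr P [set w | (x%:E < L w)%E].
  (* The two lower bounds cover the two values of the minimum; since beta >= 1, the second case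
     forces gamma < 1. *)
  have [gb|gb] := leP 1 (gammahat * beta).
    have [c c0 Hc] := ladder_tail_ge_half mxi xi_indep xi_ident xi_sym mzeta
      zeta_pos zeta_indep zeta_ident S_zeta_indep p_gt0.
    exists c => //; near=> x; rewrite (min_idPl _); last by rewrite ler_pM2r.
    by apply: Hc; near: x; exact: nbhs_pinfty_ge.
  have g1 : gamma < 1.
    rewrite ltNge; apply/negP => g1; move: gb.
    by rewrite /gammahat (min_idPl g1) mul1r ltNge b1.
  have [_ [c2 c20 [t1 t10 zeta_tail]]] := zeta_stable g1.
  have bondP x : t1^-1 + 1 <= x -> 1 <= x -> c2 <= bond_tail P zeta' x * x `^ gamma.
    move=> xt x1; have x0 : 0 < x by exact: lt_le_trans x1.
    rewrite -ler_pdivrMr ?powR_gt0// -powRV ?(ltW x0)//.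
    apply: le_trans (zeta_tail x^-1 _) _.
      by rewrite invr_gt0 x0/= invf_plt ?posrE// (lt_le_trans _ xt)// ltrDl.
    apply: le_pr.
    - apply: (measurable_lt (f := cst 1)) => //; apply: measurableT_comp => //.
      exact: measurable_funM.
    - exact: measurable_bond_gt.
    have zw w : 0 < zeta' 1 w by exact: zeta_pos.
    move=> w /=; rewrite gtr0_norm; last by rewrite mulr_gt0 ?invr_gt0.
    by rewrite mulrC ltr_pdivlMr// mul1r.
  have [c c0 Hc] := ladder_tail_ge_stable mxi xi_indep xi_ident xi_sym mzeta
    zeta_pos zeta_indep zeta_ident S_zeta_indep p_gt0 b0 g0 c10 c20 jumpP bondP.
  exists c => //; near=> x; rewrite (min_idPr _); last by rewrite ler_pM2r// ltW.
  rewrite /gammahat (min_idPr (ltW g1)).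
  by apply: Hc; near: x; apply: nbhs_pinfty_ge; exact: num_real.
have mL x : measurable [set w | (x%:E < L w)%E].
  exact: (measurable_ladder_length_gt mxi mzeta).
have [beta1|beta1] := eqVneq beta 1.
  have [G G0 HG] := trunc_moment1_bound_eq1 mstep b02 nu20 s00 xi_defect beta1.
  have [cu cu0 upP] := ladder_tail_le_log mxi xi_indep xi_ident xi_sym mzeta zeta_pos
    zeta_ident S_zeta_indep p_gt0 gh0 D0 bond_le G0 HG.
  (* At beta = 1 only the upper bound carries a logarithm; the constant below is itself slowly
     varying. *)
  exists (cst cl), (fun x => cu * ln x); split => //.
    by move=> _; split; [exact: slowly_varying_cst|exact: slowly_varying_ln].
  by apply: filterS2 lowP upP => x lo up; rewrite (prE P (mL x)) !lee_fin lo up.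
have b_gt1 : 1 < beta by rewrite lt_neqAle eq_sym beta1.
have [G G0 HG] := trunc_moment1_bound_gt1 mstep b02 nu20 s00 xi_defect b_gt1.
have [cu cu0 upP] := ladder_tail_le_linear mxi xi_indep xi_ident xi_sym mzeta zeta_pos
  zeta_ident S_zeta_indep p_gt0 gh0 D0 bond_le G0 HG.
exists (cst cl), (cst cu); split => //.
- by move=> _; split; [exists cl|exists cu].
- by move=> bE; rewrite bE eqxx in beta1.
- apply: filterS2 lowP (nbhs_pinfty_ge (num_real 1)) => x lo x1.
  by rewrite (prE P (mL x)) !lee_fin lo upP.
Unshelve. all: by end_near.
Qed.
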